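(* Up to isomorphism, the elements of $\mathcal{P}_{-5}$ are the graphs $G$ with vertex set $\mathbb{N}_n$, where $n\geq 14$, such that, with $X=\mathbb{N}_{n-5}$: $G[X]=P_{n-5}$; for each $Y\in q_X^-$ (resp. $Y\in q_X^+$), $G[Y]$ is empty (resp. complete); and the graph $G_X$ is isomorphic to the bipartite graph $P_5$, with bipartition $\{X^-,X^-(1)\}$ or $\{X^-,X^+(1)\}$ (that is, $G_X\simeq P_5$ and its two colour classes are $X^-$ and $X^-(1)$, or $X^-$ and $X^+(1)$). In other words, a graph is isomorphic to an element of $\mathcal{P}_{-5}$ if and only if it is isomorphic to a graph of this form.
   Context: Graphs are finite, simple and undirected; $G[X]$ is the subgraph induced by $X$ and $G-X=G[V(G)\setminus X]$. A graph is empty if it has no edges, complete if all pairs of distinct vertices are edges. A subset $I\subseteq V(G)$ is an interval of $G$ if every vertex outside $I$ is adjacent to all or to none of the vertices of $I$. The sets $\emptyset$, $V(G)$ and $\{x\}$ ($x\in V(G)$) are the trivial intervals. $G$ is indecomposable if all its intervals are trivial. For an indecomposable graph $G=(V,E)$, the indecomposability graph $\mathbb{I}(G)$ has vertex set $V$, and its edges are the pairs $\{x,y\}$ of distinct vertices such that $G-\{x,y\}$ is indecomposable. A graph $H$ is $X$-covered, for $X\subseteq V(H)$, if every edge of $H$ meets $X$. Let $\mathbb{N}_n=\{1,\dots,n\}$. $P_n$ is the graph on $\mathbb{N}_n$ in which $i\ne j$ are adjacent iff $|i-j|=1$ (it is indecomposable for $n\ge4$). $\mathcal{P}_{-5}$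 is the set of indecomposable graphs $G$ with vertex set $\mathbb{N}_n$ for some $n\geq 14$ such that $\mathbb{I}(G)$ is $\{1,n-5\}$-covered and $G-\{n,n-1,n-2,n-3,n-4\}=P_{n-5}$. For $G=(V,E)$ and $X\subseteq V$ with $|X|\geq 4$ and $G[X]$ indecomposable: $X^-$ (resp. $X^+$) is the set of $v\in V\setminus X$ adjacent to no vertex (resp. to every vertex) of $X$; for $u\in X$, $X(u)$ is the set of $v\in V\setminus X$ such that $\{u,v\}$ is an interval of $G[X\cup\{v\}]$, and $X^-(u)$ (resp. $X^+(u)$) is the set of $v\in X(u)$ not adjacent (resp. adjacent) to $u$. Put $q_X^-=\{X^-\}\cup\{X^-(u):u\in X\}$ and $q_X^+=\{X^+\}\cup\{X^+(u):u\in X\}$. If $|V\setminus X|\ge2$, $G_X$ is the graph with vertex set $V\setminus X$ in which $x\neq y$ are adjacent iff $G[X\cup\{x,y\}]$ is indecomposable. *)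

(* Defs.v *)
From mathcomp Require Import all_boot.
Set Implicit Arguments.
Unset Strict Implicit.
Unset Printing Implicit Defensive.

Record graph (T : finType) := Graph {
  adj : rel T;
  adj_sym : symmetric adj;
  adj_irr : irreflexive adj }.

Definition isomorphic (T U : finType) (G : graph T) (H : graph U) : Prop :=
  exists f : T -> U, bijective f /\ forall x y, adj H (f x) (f y) = adj G x y.

Definition empty_graph (T : finType) (G : graph T) : bool :=
  [forall x, forall y, ~~ adj G x y].

Definition complete_graph (T : finType) (G : graph T) : bool :=
  [forall x, forall y, (x != y) ==> adj G x y].

Section Induced.
Variables (T : finType) (G : graph T) (X : {set T}).

Definition induced_rel : rel {x : T | x \in X} := fun x y => adj G (val x) (val y).

Lemma induced_sym : symmetric induced_rel.
Proof. by move=> x y; apply: adj_sym. Qed.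

Lemma induced_irr : irreflexive induced_rel.
Proof. by move=> x; apply: adj_irr. Qed.

Definition induced : graph {x : T | x \in X} := Graph induced_sym induced_irr.

(* The trace of A on the vertex type of [induced]. *)
Definition trace (A : {set T}) : {set {x : T | x \in X}} := [set z | val z \in A].
End Induced.

Definition delete (T : finType) (G : graph T) (X : {set T}) := induced G (~: X).

Definition interval (T : finType) (G : graph T) (I : {set T}) : bool :=
  [forall v in ~: I, [forall x in I, adj G v x] || [forall x in I, ~~ adj G v x]].

Definition trivial_set (T : finType) (I : {set T}) : bool :=
  [|| I == set0, I == setT | [exists x, I == [set x]]].

Definition indecomposable (T : finType) (G : graph T) : bool :=
  [forall I : {set T}, interval G I ==> trivial_set I].

Section Indecomposability.
Variables (T : finType) (G : graph T).

Definition indec_rel : rel T :=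
  fun x y => (x != y) && indecomposable (delete G [set x; y]).

Lemma indec_rel_sym : symmetric indec_rel.
Proof. by move=> x y; rewrite /indec_rel eq_sym setUC. Qed.

Lemma indec_rel_irr : irreflexive indec_rel.
Proof. by move=> x; rewrite /indec_rel eqxx. Qed.

Definition indecomposability_graph : graph T := Graph indec_rel_sym indec_rel_irr.
End Indecomposability.

Definition covered (T : finType) (H : graph T) (X : {set T}) : bool :=
  [forall x, forall y, adj H x y ==> (x \in X) || (y \in X)].

(* Vertices of the graphs on {1, ..., n} are the ordinals i < n, and i stands
   for the number i + 1. *)
Definition label (n : nat) (i : 'I_n) : nat := i.+1.

Definition labelled (n : nat) (s : seq nat) : {set 'I_n} := [set i | label i \in s].

(* Equality of two graphs with integer vertices, the vertices being read off
   through f and g. *)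
Definition same_graph (T U : finType) (f : T -> nat) (g : U -> nat)
    (G : graph T) (H : graph U) : Prop :=
  codom f =i codom g /\
  forall x y u v, f x = g u -> f y = g v -> adj G x y = adj H u v.

Section Path.
Variable n : nat.

Definition path_rel : rel 'I_n :=
  fun i j => (label i == (label j).+1) || (label j == (label i).+1).

Lemma path_rel_sym : symmetric path_rel.
Proof. by move=> i j; rewrite /path_rel orbC. Qed.

Lemma path_rel_irr : irreflexive path_rel.
Proof. by move=> i; rewrite /path_rel orbb ltn_eqF. Qed.

Definition path_graph : graph 'I_n := Graph path_rel_sym path_rel_irr.
End Path.

Definition induces_path (n : nat) (G : graph 'I_n) (X : {set 'I_n}) (m : nat) : Prop :=
  same_graph (fun x : {x | x \in X} => label (val x)) (@label m)
    (induced G X) (path_graph m).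

Definition Pminus5 (n : nat) (G : graph 'I_n) : Prop :=
  [/\ 14 <= n,
      indecomposable G,
      covered (indecomposability_graph G) (labelled n [:: 1; n - 5])
    & induces_path G (~: labelled n [:: n; n - 1; n - 2; n - 3; n - 4]) (n - 5)].

Section Outside.
Variables (T : finType) (G : graph T) (X : {set T}).

(* X^-, X^+, X(u), X^-(u), X^+(u); outside_graph is G_X.  These are used only
   when |X| >= 4 and G[X] is indecomposable. *)
Definition Xminus : {set T} := [set v in ~: X | [forall x in X, ~~ adj G v x]].

Definition Xplus : {set T} := [set v in ~: X | [forall x in X, adj G v x]].

Definition Xtwin (u : T) : {set T} :=
  [set v in ~: X | interval (induced G (v |: X)) (trace (v |: X) [set u; v])].

Definition Xtwin_minus (u : T) : {set T} := [set v in Xtwin u | ~~ adj G u v].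

Definition Xtwin_plus (u : T) : {set T} := [set v in Xtwin u | adj G u v].

Definition q_minus : {set {set T}} := Xminus |: [set Xtwin_minus u | u in X].

Definition q_plus : {set {set T}} := Xplus |: [set Xtwin_plus u | u in X].

Definition outside_rel : rel {v : T | v \in ~: X} :=
  fun x y => (x != y) && indecomposable (induced G (X :|: [set val x; val y])).

Lemma outside_rel_sym : symmetric outside_rel.
Proof. by move=> x y; rewrite /outside_rel eq_sym [[set val x; _]]setUC. Qed.

Lemma outside_rel_irr : irreflexive outside_rel.
Proof. by move=> x; rewrite /outside_rel eqxx. Qed.

Definition outside_graph : graph {v : T | v \in ~: X} :=
  Graph outside_rel_sym outside_rel_irr.
End Outside.

Definition bipartition (T : finType) (G : graph T) (A B : {set T}) : Prop :=
  [/\ A :&: B = set0, A :|: B = setT,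
      empty_graph (induced G A) & empty_graph (induced G B)].

Definition special_form (n : nat) (G : graph 'I_n) : Prop :=
  let X := labelled n (iota 1 (n - 5)) in
  [/\ 14 <= n,
      induces_path G X (n - 5),
      forall Y, Y \in q_minus G X -> empty_graph (induced G Y),
      forall Y, Y \in q_plus G X -> complete_graph (induced G Y)
    & isomorphic (outside_graph G X) (path_graph 5) /\
      exists2 v1 : 'I_n, label v1 = 1 &
        bipartition (outside_graph G X) (trace (~: X) (Xminus G X))
                    (trace (~: X) (Xtwin_minus G X v1)) \/
        bipartition (outside_graph G X) (trace (~: X) (Xminus G X))
                    (trace (~: X) (Xtwin_plus G X v1))].

(* Main.v *)
Require Import Defs.
From mathcomp Require Import all_boot.
From mathcomp Require Import zify.
Set Implicit Arguments.
Unset Strict Implicit.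
Unset Printing Implicit Defensive.

(* Let m = n - 5 and X = {1, ..., m}.  If Z contains 1 and m, G[Z] is
   indecomposable and |V \ Z| is even and positive, then, by the theorem of
   Ehrenfeucht and Rozenberg, Z can be enlarged two vertices at a time until
   V \ Z is a pair {x, y} avoiding 1 and m with G - {x, y} indecomposable.
   Hence there is no such Z when G is in P_{-5}.  Taking for Z the set X with
   one or three vertices added, every outside vertex lies in some X^-, X^+ or
   X(u), and the indecomposability of G forces G_X to be P_5, each colour class
   lying in a single set of q_X^- or q_X^+.  If one of them is X^-(u) or X^+(u)
   with 1 < u < m, exchanging u for one of its twins and adding one or three
   outside vertices produces a forbidden Z.  The pairs X^+, X(1) and X(1), X(m)
   are excluded by shortening the path to m - 2 or m - 3 vertices and adding one
   vertex of each class, then the last one or two vertices of the path.  What is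
   left, up to reversal of the path, is an explicit family of graphs.  In these,
   deleting a vertex i with 1 < i < m disconnects the path, and deleting two
   outside vertices leaves an isolated vertex or two twins. *)

(** * Blocks of an indecomposable subgraph *)

(** Five is odd, so the forbidden sets containing X are those with one or three added vertices; two
    may be added, and the pairs whose addition is indecomposable are the edges of G_X. The obstacle
    is that the blocks of X say nothing about adjacency among the five outside vertices. The remedy
    is [std]: the block of an outside vertex x dictates an expected adjacency to every other outside
    vertex. Across two blocks, a deviation from it is an edge of G_X; inside one member of q_X^- or
    q_X^+, it is a deviation from the empty or complete graph. So one boolean table on five vertices
    carries both G_X and the graphs G[Y], and P_5 is the only shape compatible with two facts: no
    third vertex extends an edge of G_X, and twins over X are separated by some outside vertex.
    Which colour class is X^-, and which end of the path has twins, is not determined; hence the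
    parameters [par] and [sgn] of the explicit family and the passage to isomorphism classes. *)

Section Blocks.
Variables (T : finType) (G : graph T).
Implicit Types (x y z u v w : T) (X Y Z I : {set T}) (b c d : option T).
Local Notation adj := (adj G).

Definition indec Y := indecomposable (induced G Y).

(** This keeps the subtype out of all later arguments. The empty set and the singletons are merged
    into the condition that all elements of [I] are equal. *)
Lemma indecP Y :
  reflect (forall I, I \subset Y ->
             (forall v x y, v \in Y -> v \notin I -> x \in I -> y \in I ->
                adj v x = adj v y) ->
             (forall x y, x \in I -> y \in I -> x = y) \/ I = Y)
          (indec Y).
Proof.
apply: (iffP forallP) => [indY I sIY mI | indY J].
- have := indY (trace Y I); rewrite implybE => /orP[/negP[]|].
    apply/forall_inP => -[v vY]; rewrite !inE /= => vI.
    case: (boolP [forall x in trace Y I, _]) => //=.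
    rewrite negb_forall_in => /exists_inP[[x xY]].
    rewrite inE /= => xI nvx; apply/forall_inP => -[y yY]; rewrite inE /= => yI.
    by move: nvx; rewrite /= /induced_rel /= (mI v x y).
  case/or3P => [/eqP J0|/eqP JT|/existsP[z /eqP Jz]].
  + left=> x y xI; have := in_set0 (Sub x (subsetP sIY x xI) : {x | x \in Y}).
    by rewrite -J0 inE /= xI.
  + right; apply/eqP; rewrite eqEsubset sIY; apply/subsetP => x xY.
    by have := in_setT (Sub x xY : {x | x \in Y}); rewrite -JT inE.
  + have E x : x \in I -> x = val z => [xI|].
      have : (Sub x (subsetP sIY x xI) : {x | x \in Y}) \in trace Y I by rewrite inE.
      by rewrite Jz inE => /eqP <-.
    by left=> x y /E-> /E->.
- apply/implyP => /forall_inP mJ; rewrite /trivial_set.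
  have memJ (z : {x | x \in Y}) : (val z \in [set val s | s in J]) = (z \in J).
    by rewrite mem_imset //; apply: val_inj.
  have [||J1|JY] := indY [set val z | z in J].
  + by apply/subsetP => _ /imsetP[z _ ->]; apply: (valP z).
  + move=> v _ _ vY vJ /imsetP[x xJ ->] /imsetP[y yJ ->].
    have := mJ (Sub v vY); rewrite inE -memJ => /(_ vJ) /orP[]/forall_inP h.
      by have /= := h x xJ; have /= := h y yJ; rewrite /induced_rel /= => -> ->.
    have /= := h x xJ; have /= := h y yJ; rewrite /induced_rel /=.
    by move=> /negPf-> /negPf->.
  + have [->|[z zJ]] := set_0Vmem J; first by rewrite eqxx.
    apply/or3P/Or33/existsP; exists z; apply/eqP/setP => t; rewrite inE.
    apply/idP/eqP => [tJ|->//]; apply: val_inj.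
    by apply: J1; apply: imset_f.
  + apply/or3P/Or32/eqP/setP => z; rewrite inE -memJ JY; exact: valP z.
Qed.

(* Block [None] stands for [X^-] and [X^+] together, block [Some u] for [X(u)];
   these are meant for [x] outside [Y]. *)
Definition in_block Y b x :=
  if b is Some u then u \in Y /\ forall z, z \in Y -> z != u -> adj x z = adj u z
  else forall y z, y \in Y -> z \in Y -> adj x y = adj x z.

Definition in_blockb Y b x :=
  if b is Some u then (u \in Y) && [forall z in Y, (z != u) ==> (adj x z == adj u z)]
  else [forall y in Y, forall z in Y, adj x y == adj x z].

Lemma in_blockP Y b x : reflect (in_block Y b x) (in_blockb Y b x).
Proof.
case: b => [u|]; last first.
  apply: (iffP forall_inP) => [h y z /h/forall_inP/[apply]/eqP // | h y yY].
  by apply/forall_inP => z zY; rewrite (h y z).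
apply: (iffP andP) => -[uY h]; split=> //.
  by move=> z zY zu; apply/eqP; move/forall_inP/(_ z zY): h; rewrite zu.
by apply/forall_inP => z zY; apply/implyP => zu; rewrite h.
Qed.

Lemma in_blockS Y Z b x :
  Y \subset Z -> in_block Z b x -> (forall u, b = Some u -> u \in Y) -> in_block Y b x.
Proof.
move=> /subsetP sYZ; case: b => [u|] /=; last by move=> h _ y z /sYZ ? /sYZ; apply: h.
by case=> _ h /(_ _ erefl) uY; split=> // z /sYZ; apply: h.
Qed.

Lemma in_block_eq Y b x y :
  (forall z, z \in Y -> adj x z = adj y z) -> in_block Y b x -> in_block Y b y.
Proof.
move=> e; case: b => [u [uY h]|h] /=; last by move=> s t sY tY; rewrite -!e //; apply: h.
by split=> // z zY zu; rewrite -e // h.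
Qed.

(** If [x] were in the blocks [None] and [Some u], then [Y :\ u] would be an interval of G[Y]; if in
    [Some u] and [Some v], then [[set u; v]] would be one. Three vertices make these intervals
    nontrivial. *)
Lemma in_block_uniq Y b c x :
  indec Y -> 2 < #|Y| -> in_block Y b x -> in_block Y c x -> b = c.
Proof.
move=> /indecP indY Y3.
have nS u : in_block Y None x -> in_block Y (Some u) x -> False.
  move=> h [uY hu]; case: (indY (Y :\ u)).
  - exact: subD1set.
  - move=> v y z vY; rewrite !inE vY andbT negbK => /eqP-> /andP[yu yY] /andP[zu zY].
    by rewrite -!hu //; apply: h.
  - move=> h1; have : 1 < #|Y :\ u| by rewrite [#|Y|](cardsD1 u) uY in Y3.
    by case/card_gt1P=> y [z [/h1 yz /yz ->]]; rewrite eqxx.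
  - by move=> /setP/(_ u); rewrite !inE eqxx uY.
case: b c => [u|] [v|] // hu hv; try by case: (nS _ hu hv) || case: (nS _ hv hu).
case: (altP (u =P v)) => [->//|uv].
case: hu hv => [uY hu] [vY hv].
case: (indY [set u; v]).
- by rewrite subUset !sub1set uY.
- have K w : w \in Y -> w \notin [set u; v] -> adj u w = adj v w.
    by rewrite !inE negb_or => wY /andP[wu wv]; rewrite -hu // hv.
  move=> w y z wY wI; have E := K w wY wI.
  by rewrite !inE => /orP[]/eqP-> /orP[]/eqP->; rewrite // ![adj w _]adj_sym.
- by move/(_ u v); rewrite !inE !eqxx orbT => /(_ isT isT) ->.
- by move=> YE; move: Y3; rewrite -YE cards2; case: (u != v).
Qed.

(** The trace on [Y] of an interval of [v |: Y] is an interval of G[Y]. For a nontrivial interval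
    the trace is a single [u], which puts [v] in block [Some u], or all of [Y], which puts [v] in
    block [None]. *)
Lemma indecU1 Y v : indec Y -> v \notin Y -> indec (v |: Y) \/ exists b, in_block Y b v.
Proof.
move=> /indecP indY vY; have [[b /in_blockP h]|nb] := altP (@existsP (option T) (fun b => in_blockb Y b v)).
  by right; exists b.
left; apply/indecP => I sI mI.
have memY z : z \in v |: Y -> z != v -> z \in Y by rewrite !inE => /orP[->|].
have [||I1|IY] := indY (I :&: Y); first exact: subsetIr.
- move=> w x y wY; rewrite !inE wY andbT => wI /andP[xI _] /andP[yI _].
  by apply: mI; rewrite // !inE wY orbT.
- case: (boolP (v \in I)) => vI; last first.
    left=> x y xI yI; apply: I1; rewrite inE ?xI ?yI; apply: memY; rewrite ?(subsetP sI) //.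
      by apply: contraNneq vI => <-.
    by apply: contraNneq vI => <-.
  case: (set_0Vmem (I :&: Y)) => [I0|[u]].
    left; suff E x : x \in I -> x = v by move=> x y /E-> /E->.
    move=> xI; apply/eqP/negPn/negP => xv; have : x \in I :&: Y by rewrite inE xI memY // (subsetP sI).
    by rewrite I0 inE.
  rewrite inE => /andP[uI uY]; case/existsP: nb; exists (Some u); apply/in_blockP; split=> // z zY zu.
  rewrite adj_sym [adj u z]adj_sym; apply: mI => //; first by rewrite !inE zY orbT.
  by apply: contra zu => zI; apply/eqP/I1; rewrite inE ?zI ?uI.
- have sYI : Y \subset I by rewrite -IY subsetIl.
  case: (boolP (v \in I)) => vI.
    by right; apply/eqP; rewrite eqEsubset sI subUset sub1set vI.
  case/existsP: nb; exists None; apply/in_blockP => y z /(subsetP sYI) ? /(subsetP sYI) ?.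
  by apply: mI => //; rewrite !inE eqxx.
Qed.


(** Given the blocks over [Y], each side only fixes the adjacency of [x] and [y], and both fix it to
    the same value: that of [u] and [v] for blocks [Some u] and [Some v], that of [u] and the vertex
    in block [None] for [Some u] and [None]. *)
Lemma in_block_sym Y b c x y :
  b <> c -> x \notin Y -> y \notin Y -> in_block Y b x -> in_block Y c y ->
  in_block (y |: Y) b x -> in_block (x |: Y) c y.
Proof.
move=> bc xY yY; case: b c bc => [u|] [v|] // bc.
- move=> [uY hu] [vY hv] [_ H]; split=> [|z]; first by rewrite !inE vY orbT.
  have uv : u != v by apply/eqP => E; apply: bc; rewrite E.
  have yu : y != u by apply: contraNneq yY => ->.
  rewrite !inE => /orP[/eqP-> _|]; last exact: hv.
  rewrite adj_sym H ?inE ?eqxx // adj_sym hv // adj_sym -hu // 1?eq_sym //.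
  by rewrite adj_sym.
- move=> [uY hu] hy [_ H] s t.
  have yu : y != u by apply: contraNneq yY => ->.
  have K w : w \in x |: Y -> adj y w = adj y u.
    rewrite !inE => /orP[/eqP->|wY]; last exact: hy.
    by rewrite adj_sym H ?inE ?eqxx // adj_sym.
  by move=> /K-> /K->.
- move=> hx [vY hv] H; split=> [|z]; first by rewrite !inE vY orbT.
  rewrite !inE => /orP[/eqP-> _|]; last exact: hv.
  by rewrite adj_sym [RHS]adj_sym; apply: H; rewrite !inE ?eqxx ?vY ?orbT.
Qed.

Lemma in_block_not_indecU2 Y b x y :
  1 < #|Y| -> x \notin Y -> y \notin Y -> x != y ->
  in_block (y |: Y) b x -> b <> Some y -> ~~ indec (x |: (y |: Y)).
Proof.
move=> Y2 xY yY xy h by_; apply/negP => /indecP indY.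
have [p [q [pY qY pq]]] := card_gt1P Y2.
case: b h by_ => [u [uY hu] nuy|h _].
  have {}uY : u \in Y by move: uY; rewrite !inE => /orP[/eqP E|//]; rewrite E in nuy.
  have ux : u != x by apply: contraNneq xY => <-.
  have uy : u != y by apply: contraNneq yY => <-.
  case: (indY [set u; x]).
  - by rewrite subUset !sub1set !inE uY eqxx !orbT.
  - have K w : w \in y |: Y -> w \notin [set u; x] -> adj w x = adj w u.
      by rewrite !inE negb_or => wY /andP[wu wx]; rewrite adj_sym hu 1?adj_sym // !inE.
    move=> v s t vI vux; have vY : v \in y |: Y.
      by move: vI vux; rewrite !inE negb_or => /orP[->|//]; rewrite andbF.
    by rewrite !inE => /orP[]/eqP-> /orP[]/eqP->; rewrite ?K.
  - by move/(_ u x); rewrite !inE !eqxx orbT => /(_ isT isT) /eqP; apply/negP.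
  - move/setP/(_ y); rewrite !inE eqxx orbT => /orP[]/eqP E.
      by rewrite E eqxx in uy.
    by rewrite E eqxx in xy.
case: (indY (y |: Y)); first exact: subsetUr.
- move=> v s t; rewrite !inE => /orP[/eqP->|->//] _ sI tI; apply: h; by rewrite !inE.
- by move/(_ p q); rewrite !inE pY qY !orbT => /(_ isT isT) /eqP; apply/negP.
- by move/setP/(_ x); rewrite !inE eqxx (negPf xY) (negPf xy).
Qed.

(** Whatever the adjacency of [x] and [y], one block gives the interval [[set u; x; y]] or [Y]. *)
Lemma same_block_not_indecU2 Y b x y :
  1 < #|Y| -> x \notin Y -> y \notin Y ->
  in_block Y b x -> in_block Y b y -> ~~ indec (x |: (y |: Y)).
Proof.
move=> Y2 xY yY hx hy; apply/negP => /indecP indY.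
have [p [q [pY qY pq]]] := card_gt1P Y2.
case: b hx hy => [u [uY hu] [_ hv]|hx hy].
  have ux : u != x by apply: contraNneq xY => <-.
  have uy : u != y by apply: contraNneq yY => <-.
  case: (indY [set u; x; y]).
  - by rewrite !subUset !sub1set !inE uY !eqxx !orbT.
  - move=> v s t; rewrite !inE !negb_or => vI /andP[/andP[vu vx] vy].
    move: vI; rewrite (negPf vx) (negPf vy) => /= vY.
    by move=> /orP[/orP[]|]/eqP-> /orP[/orP[]|]/eqP->;
      rewrite // ![adj v _]adj_sym ?hu ?hv.
  - by move/(_ u x); rewrite !inE !eqxx orbT => /(_ isT isT) /eqP; apply/negP.
  - move=> E; pose r := if p == u then q else p.
    have rY : r \in Y by rewrite /r; case: ifP.
    have ru : r != u by rewrite /r; case: ifPn => // /eqP<-; rewrite eq_sym.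
    move/setP/(_ r): E; rewrite !inE rY !orbT => /orP[/orP[]|]/eqP E.
    + by rewrite E eqxx in ru.
    + by rewrite -E rY in xY.
    + by rewrite -E rY in yY.
case: (indY Y).
- by rewrite setUA subsetUr.
- move=> v s t vI vY sY tY; move: vI; rewrite !inE (negPf vY) orbF.
  by case/orP => /eqP->; [apply: hx | apply: hy].
- by move/(_ p q pY qY)/eqP; apply/negP.
- by move/setP/(_ x); rewrite !inE eqxx (negPf xY).
Qed.

(** The trace of an interval on [Y] is empty, a point or [Y]. If [x] and [y] are on the same side of
    a nontrivial interval, they get the same block; if on different sides, one of them keeps its
    block when the other is added, which [nstd] and its mirror image [nstd'] exclude. *)
Lemma indecU2 Y b c x y :
  indec Y -> 2 < #|Y| -> x \notin Y -> y \notin Y -> x != y -> b <> c ->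
  in_block Y b x -> in_block Y c y -> ~ in_block (y |: Y) b x ->
  indec (x |: (y |: Y)).
Proof.
move=> indY Y3 xY yY xy bc hx hy nstd; apply/indecP => I sI mI.
have uniq d e z := @in_block_uniq Y d e z indY Y3.
have cb : c <> b by move=> E; apply: bc.
have nstd' : ~ in_block (x |: Y) c y by move/(in_block_sym cb yY xY hy hx).
have sY z : z \in Y -> z \in x |: (y |: Y) by move=> zY; rewrite !inE zY !orbT.
have memI z : z \in I -> [|| z == x, z == y | z \in Y].
  by move/(subsetP sI); rewrite !inE.
have [||I1|IY] := elimT (indecP Y) indY (I :&: Y); first exact: subsetIr.
- move=> w s t wY; rewrite !inE wY andbT => wI /andP[sI' _] /andP[tI _].
  by apply: mI; rewrite ?sY.
- have twin u w : w \notin Y -> u \in I -> u \in Y -> w \in I ->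
      in_block Y (Some u) w.
    move=> wY uI uY wI; split=> // z zY zu; rewrite adj_sym [RHS]adj_sym.
    apply: mI => //; first exact: sY.
    by apply: contra zu => zI; apply/eqP/I1; rewrite inE ?zI ?uI.
  have bE d z u : z \notin Y -> in_block Y d z -> u \in I -> u \in Y -> z \in I -> d = Some u.
    by move=> zY hz uI uY zI; apply: uniq hz (twin u z zY uI uY zI).
  case: (set_0Vmem (I :&: Y)) => [I0|[u]].
    have nI z : z \in I -> z \notin Y.
      by move=> zI; apply: contraT; rewrite negbK => zY; have := in_set0 z; rewrite -I0 inE zI zY.
    case: (boolP (x \in I)) => xI; case: (boolP (y \in I)) => yI.
    + case: bc; apply: (uniq _ _ y) => //; apply: in_block_eq hx => z zY.
      rewrite adj_sym [RHS]adj_sym; apply: mI => //; first exact: sY.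
      by apply: contraL zY; apply: nI.
    + left; suff E z : z \in I -> z = x by move=> s t /E-> /E->.
      move=> zI; case/or3P: (memI z zI) => [/eqP->//|/eqP zy|]; last by rewrite (negPf (nI z zI)).
      by rewrite -zy zI in yI.
    + left; suff E z : z \in I -> z = y by move=> s t /E-> /E->.
      move=> zI; case/or3P: (memI z zI) => [/eqP zx|/eqP->//|]; last by rewrite (negPf (nI z zI)).
      by rewrite -zx zI in xI.
    + left=> z; suff : z \notin I by move=> /negPf->.
      apply/negP => zI; case/or3P: (memI z zI) => [/eqP zx|/eqP zy|]; last by rewrite (negPf (nI z zI)).
        by rewrite -zx zI in xI.
      by rewrite -zy zI in yI.
  rewrite inE => /andP[uI uY].
  have ux : u != x by apply: contraNneq xY => <-.
  have uy : u != y by apply: contraNneq yY => <-.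
  case: (boolP (x \in I)) => xI; case: (boolP (y \in I)) => yI.
  + by case: bc; rewrite (bE b x u xY hx uI uY xI) (bE c y u yY hy uI uY yI).
  + case: nstd; rewrite (bE b x u xY hx uI uY xI).
    split; first by rewrite inE uY orbT.
    move=> z; rewrite !inE => /orP[/eqP-> _|zY zu]; last by case: (twin u x) => // _; apply.
    by rewrite adj_sym [RHS]adj_sym; apply: mI; rewrite ?inE ?eqxx ?orbT.
  + case: nstd'; rewrite (bE c y u yY hy uI uY yI).
    split; first by rewrite inE uY orbT.
    move=> z; rewrite !inE => /orP[/eqP-> _|zY zu]; last by case: (twin u y) => // _; apply.
    by rewrite adj_sym [RHS]adj_sym; apply: mI; rewrite ?inE ?eqxx.
  + left; suff E z : z \in I -> z = u by move=> s t /E-> /E->.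
    move=> zI; case/or3P: (memI z zI) => [/eqP zx|/eqP zy|zY].
    * by rewrite -zx zI in xI.
    * by rewrite -zy zI in yI.
    * by apply: I1; rewrite inE ?zI ?uI.
- have sYI z : z \in Y -> z \in I by rewrite -{1}IY inE => /andP[].
  have bE d z : z \in x |: (y |: Y) -> z \notin I -> in_block Y d z -> d = None.
    move=> zW zI hz; apply: uniq hz _ => s t /sYI sI' /sYI tI.
    exact: mI.
  have nstdI d z w : z \in x |: (y |: Y) -> z \notin I -> w \in I -> in_block Y d z ->
      in_block (w |: Y) d z.
    move=> zW zI wI hz; rewrite (bE d z zW zI hz) => s t sw tw.
    apply: mI => //; [move: sw | move: tw]; by rewrite !inE => /orP[/eqP->|/sYI].
  have [xW yW] : x \in x |: (y |: Y) /\ y \in x |: (y |: Y) by rewrite !inE !eqxx orbT.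
  case: (boolP (x \in I)) => xI; case: (boolP (y \in I)) => yI.
  + right; apply/eqP; rewrite eqEsubset sI !subUset !sub1set xI yI.
    by apply/subsetP.
  + by case: nstd'; apply: nstdI.
  + by case: nstd; apply: nstdI.
  + by case: bc; rewrite (bE b x xW xI hx) (bE c y yW yI hy).
Qed.

Lemma in_block_not_indecU1 Y b x :
  2 < #|Y| -> x \notin Y -> in_block Y b x -> ~~ indec (x |: Y).
Proof.
move=> Y3 xY hx; apply/negP => /indecP indY.
have [p [q [pY qY pq]]] := card_gt1P (ltnW Y3).
case: b hx => [u [uY hu]|hx].
  have ux : u != x by apply: contraNneq xY => <-.
  case: (indY [set u; x]).
  - by rewrite subUset !sub1set !inE uY eqxx !orbT.
  - move=> v s t; rewrite !inE negb_or => vI /andP[vu vx].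
    move: vI; rewrite (negPf vx) => /= vY.
    by move=> /orP[]/eqP-> /orP[]/eqP->; rewrite // ![adj v _]adj_sym ?hu.
  - by move/(_ u x); rewrite !inE !eqxx orbT => /(_ isT isT) /eqP; apply/negP.
  - by move=> YE; move: (leq_trans Y3 (subset_leq_card (subsetUr [set x] Y)));
      rewrite -YE cards2; case: (u != x).
case: (indY Y); first exact: subsetUr.
- move=> v s t vI vY sY tY; move: vI; rewrite !inE (negPf vY) orbF => /eqP->.
  exact: hx.
- by move/(_ p q pY qY)/eqP; apply/negP.
- by move/setP/(_ x); rewrite !inE eqxx (negPf xY).
Qed.

Lemma indecU1P Y v : indec Y -> v \notin Y -> ~~ indec (v |: Y) -> exists b, in_block Y b v.
Proof. by move=> indY vY /negP nind; case: (indecU1 indY vY). Qed.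

(** Suppose no pair works. Then three kinds of sets are intervals of G[W], hence trivial: the set
    [E] of vertices that extend [Y] alone, a vertex [u] of [Y] together with the block [Some u], and
    finally [Y :|: E]. This leaves at most one vertex outside [Y]. *)
Lemma ehrenfeucht_rozenberg Y W :
  indec Y -> 2 < #|Y| -> indec W -> Y \subset W -> 1 < #|W :\: Y| ->
  exists x y, [/\ x \in W :\: Y, y \in W :\: Y, x != y & indec (x |: (y |: Y))].
Proof.
move=> indY Y3 indW sYW WY2.
have [/existsP[x /existsP[y /and4P[]]]|/existsPn none] :=
    boolP [exists x, exists y, [&& x \in W :\: Y, y \in W :\: Y, x != y & indec (x |: (y |: Y))]].
  by exists x, y.
exfalso.
have {}none x y : x \in W :\: Y -> y \in W :\: Y -> x != y -> ~~ indec (x |: (y |: Y)).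
  move=> xW yW xy; apply/negP => h.
  by have /existsPn/(_ y)/and4P := none x; apply.
have notY x : x \in W :\: Y -> x \notin Y by rewrite inE => /andP[].
have [p [q [pY qY pq]]] := card_gt1P (ltnW Y3).
pose E := [set x in W :\: Y | indec (x |: Y)].
have EW x : x \in E -> x \in W :\: Y by rewrite inE => /andP[].
have Eindec x : x \in E -> indec (x |: Y) by rewrite inE => /andP[].
have block_n b x : x \in E -> ~ in_block Y b x.
  move=> xE /(in_block_not_indecU1 Y3 (notY _ (EW _ xE))).
  by rewrite Eindec.
have block_ex z : z \in W :\: Y -> z \notin E -> exists b, in_block Y b z.
  move=> zW; rewrite inE zW /= => zE; exact: indecU1P (notY _ zW) zE.
have E_block x z : x \in E -> z \in W :\: Y -> z != x -> exists2 d, in_block (x |: Y) d z &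
    d = Some x \/ in_block Y d z.
  move=> xE zW zx.
  have [|d hd] := indecU1P (Eindec _ xE) _ (none z x zW (EW _ xE) zx).
    by rewrite !inE negb_or zx notY.
  exists d => //; case: (eqVneq d (Some x)) => [|dx]; [by left | right].
  apply: (in_blockS (subsetUr _ _) hd) => u du; have : u \in x |: Y by case: d du hd {dx} => // _ [->] [].
  by rewrite !inE => /orP[/eqP ux|//]; rewrite du ux eqxx in dx.
have E_std x z b : x \in E -> z \in W :\: Y -> z \notin E -> in_block Y b z ->
    in_block (x |: Y) b z.
  move=> xE zW zE hb; have zx : z != x by apply: contraNneq zE => ->.
  have [d hd [dx|hd']] := E_block x z xE zW zx; last by rewrite (in_block_uniq indY Y3 hb hd').
  case: (block_n b x xE); apply: in_block_eq hb => t tY.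
  rewrite dx in hd; case: hd => _; apply; first by rewrite !inE tY orbT.
  by apply: contraNneq (notY _ (EW _ xE)) => <-.
have E_twin x x' t : x \in E -> x' \in E -> t \in Y -> adj x t = adj x' t.
  move=> xE x'E tY; case: (eqVneq x' x) => [->//|xx'].
  have [d hd [dx|hd']] := E_block x x' xE (EW _ x'E) xx'; last by case: (block_n d x' x'E).
  rewrite dx in hd; case: hd => _ hd; rewrite hd // ?inE ?tY ?orbT //.
  by apply: contraNneq (notY _ (EW _ xE)) => <-.
have E_same v s t : v \in W -> v \notin E -> s \in E -> t \in E -> adj v s = adj v t.
  move=> vW vE sE tE; case: (boolP (v \in Y)) => vY.
    by rewrite adj_sym [RHS]adj_sym; apply: E_twin.
  have vW' : v \in W :\: Y by rewrite inE vY.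
  have [b hb] := block_ex v vW' vE.
  have := E_std s v b sE vW' vE hb; have := E_std t v b tE vW' vE hb.
  case: b hb => [u [uY _] [_ ht] [_ hs]|_ ht hs].
    have neq r : r \in E -> r != u by move=> /EW/notY; apply: contraNneq => ->.
    rewrite hs ?neq // ?inE ?eqxx // ht ?neq // ?inE ?eqxx // adj_sym [RHS]adj_sym.
    exact: E_twin.
  by rewrite (hs s p) ?(ht t p) // !inE ?eqxx ?pY ?orbT.
have E1 x y : x \in E -> y \in E -> x = y.
  have [||E1|EqW] := elimT (indecP W) indW E; first by apply/subsetP => z /EW; rewrite inE => /andP[].
  - exact: E_same.
  - exact: E1.
  - by have := subsetP sYW p pY; rewrite -EqW => /EW/notY; rewrite pY.
(* Otherwise [z] and [w] would be a pair as wanted, by [indecU2]. *)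
have std z w b c : z \in W :\: Y -> z \notin E -> w \in W :\: Y -> w \notin E ->
    in_block Y b z -> in_block Y c w -> b <> c -> in_block (w |: Y) b z.
  move=> zW zE wW wE hb hc bc; apply/in_blockP/negPn/negP => /in_blockP nstd.
  have zw : z != w.
    apply/eqP => zw; apply: bc; rewrite zw in hb; exact: in_block_uniq hb hc.
  by have := none z w zW wW zw; rewrite (indecU2 indY Y3 _ _ zw bc hb hc nstd) ?notY.
have noSome z u : z \in W :\: Y -> z \notin E -> ~ in_block Y (Some u) z.
  move=> zW zE hz; have uY : u \in Y by case: hz.
  have zu : z != u by apply: contraNneq (notY _ zW) => ->.
  pose M := u |: [set t in (W :\: Y) :\: E | in_blockb Y (Some u) t].
  have MP t : t \in M -> t = u \/ [/\ t \in W :\: Y, t \notin E & in_block Y (Some u) t].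
    rewrite in_setU1 in_set in_setD => /orP[/eqP|/andP[/andP[tE tW] /in_blockP]]; first by left.
    by right.
  have Mw w t : w \in W -> w \notin M -> t \in M -> adj w t = adj w u.
    move=> wW wM /MP[->//|[tW tE ht]].
    have wu : w != u by apply: contraNneq wM => ->; rewrite !inE eqxx.
    rewrite adj_sym [RHS]adj_sym; case: (boolP (w \in Y)) => wY; first by case: ht => _; apply.
    have wW' : w \in W :\: Y by rewrite inE wY.
    case: (boolP (w \in E)) => wE.
      by case: (E_std w t _ wE tW tE ht) => _; apply => //; rewrite !inE eqxx.
    have [c hc] := block_ex w wW' wE.
    have [uc|uc] := eqVneq (Some u) c.
      case/negP: wM; rewrite in_setU1 in_set in_setD wE wW' orbC.
      by apply/orP; left; rewrite !andTb; apply/in_blockP; rewrite uc.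
    case: (std t w _ c tW tE wW' wE ht hc (elimN eqP uc)) => _; apply=> //.
    by rewrite !inE eqxx.
  have [||M1|MW] := elimT (indecP W) indW M.
  - apply/subsetP => t /MP[->|[]]; [exact: (subsetP sYW) | by rewrite inE => /andP[]].
  - by move=> w s t wW wM sM tM; rewrite (Mw w s) // (Mw w t).
  - have uM : u \in M by rewrite !inE eqxx.
    have zM : z \in M.
      by rewrite in_setU1 in_set in_setD zE zW orbC; apply/orP; left; rewrite !andTb; apply/in_blockP.
    by case/eqP: zu; apply: M1.
  - have : 1 < #|Y :\ u| by rewrite [#|Y|](cardsD1 u) uY in Y3.
    case/card_gt1P => r [_ [rY _ _]]; move: rY; rewrite !inE => /andP[ru rY].
    have := subsetP sYW r rY; rewrite -MW => /MP[/eqP|[/notY]]; first by rewrite (negPf ru).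
    by rewrite rY.
(* Only the block [None] is left for vertices outside [E], so none of them separates [Y :|: E]. *)
have EN z : z \in W :\: Y -> z \in E.
  move=> zW; apply/negPn/negP => zE.
  have hN t : t \in W :\: Y -> t \notin E -> in_block Y None t.
    by move=> tW tE; have [[u /(noSome t u tW tE)[]|//]] := block_ex t tW tE.
  have [||M1|MW] := elimT (indecP W) indW (Y :|: E).
  - by rewrite subUset sYW; apply/subsetP => x /EW; rewrite inE => /andP[].
  - move=> v s t vW; rewrite in_setU negb_or => /andP[vY vE].
    have vW' : v \in W :\: Y by rewrite inE vY.
    have K r : r \in Y :|: E -> adj v r = adj v p.
      rewrite in_setU => /orP[rY|rE]; first exact: hN.
      by apply: (E_std r v None rE vW' vE (hN v vW' vE)); rewrite !inE ?eqxx ?pY ?orbT.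
    by move=> /K-> /K->.
  - by case/eqP: pq; apply: M1; rewrite in_setU ?pY ?qY.
  - have : z \in Y :|: E by rewrite MW; move: zW; rewrite inE => /andP[].
    by rewrite in_setU (negPf zE) (negPf (notY z zW)).
have /card_gt1P[x [y [xW yW xy]]] := WY2.
case/eqP: xy; by apply: E1; apply: EN.
Qed.

(** Evenness makes the growth by pairs stop with exactly two vertices left over; these are the
    removed ones. *)
Lemma indec_remove_pair k Y W :
  indec Y -> 2 < #|Y| -> indec W -> Y \subset W -> #|W :\: Y| = k.*2.+2 ->
  exists x y, [/\ x \in W :\: Y, y \in W :\: Y, x != y & indec (W :\: [set x; y])].
Proof.
elim: k Y => [|k IH] Y indY Y3 indW sYW card.
  have /cards2P[x [y [xy WE]]] : #|W :\: Y| == 2 by rewrite card.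
  exists x, y; rewrite WE !inE !eqxx orbT; split=> //.
  by rewrite -WE setDDr setDv set0U (setIidPr sYW).
have [|x [y [xW yW xy indY']]] := ehrenfeucht_rozenberg indY Y3 indW sYW; first by rewrite card.
have sY'W : x |: (y |: Y) \subset W.
  by move: xW yW; rewrite !subUset !sub1set sYW !inE => /andP[_ ->] /andP[_ ->].
have sub z : z \in W :\: (x |: (y |: Y)) -> z \in W :\: Y.
  by rewrite !inE !negb_or => /andP[/and3P[_ _ ->] ->].
have cardY' : #|x |: (y |: Y)| = #|Y|.+2.
  rewrite !cardsU1 !inE negb_or xy; move: xW yW; rewrite !inE => /andP[-> _] /andP[-> _].
  by [].
have [|||||s [t [sW tW st ind]]] := IH (x |: (y |: Y)) => //.
- by rewrite cardY'; lia.
- have := cardsDS sYW; have := cardsDS sY'W; rewrite cardY' card.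
  by move: (subset_leq_card sY'W); rewrite cardY' doubleS; lia.
- by exists s, t; split=> //; apply: sub.
Qed.
End Blocks.

Lemma indec_imset (T U : finType) (G : graph T) (H : graph U) (f : T -> U) (Y : {set T}) :
  {in Y &, injective f} -> {in Y &, forall x y, adj H (f x) (f y) = adj G x y} ->
  indec G Y -> indec H (f @: Y).
Proof.
move=> injf adjf /indecP indY; apply/indecP => I sI mI.
pose J := [set x in Y | f x \in I].
have IJ : I = f @: J.
  apply/setP => z; apply/idP/imsetP => [zI|[x + ->]]; last by rewrite inE => /andP[].
  have /imsetP[x xY zx] := subsetP sI z zI.
  by exists x => //; rewrite inE xY -zx.
have [||J1|JY] := indY J.
- by apply/subsetP => x; rewrite inE => /andP[].
- move=> v x y vY; rewrite !inE vY /= => vI /andP[xY xI] /andP[yY yI].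
  by rewrite -!adjf //; apply: mI => //; apply: imset_f.
- by left=> x y; rewrite IJ => /imsetP[s sJ ->] /imsetP[t tJ ->]; rewrite (J1 s t).
- by right; rewrite IJ JY.
Qed.

(** The map that sends [u] to its twin [v] and fixes the rest of [Y] is an isomorphism of induced
    subgraphs. *)
Lemma indec_swap (T : finType) (G : graph T) (Y : {set T}) u v :
  indec G Y -> v \notin Y -> in_block G Y (Some u) v -> indec G (v |: (Y :\ u)).
Proof.
move=> indY vY [uY hv].
pose f z := if z == u then v else z.
have -> : v |: (Y :\ u) = f @: Y.
  apply/setP => z; rewrite !inE; apply/idP/imsetP.
    case/orP => [/eqP->|/andP[zu zY]]; first by exists u; rewrite // /f eqxx.
    by exists z; rewrite // /f (negPf zu).
  by case=> x xY ->; rewrite /f; case: (eqVneq x u) => [_|xu]; rewrite ?eqxx // xu xY orbT.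
apply: indec_imset indY.
  move=> x y xY yY; rewrite /f; case: (eqVneq x u) => [->|_]; case: (eqVneq y u) => [->|_] // E.
    by rewrite E yY in vY.
  by rewrite -E xY in vY.
move=> x y xY yY; rewrite /f; case: (eqVneq x u) => [->|xu]; case: (eqVneq y u) => [->|yu] //.
- by rewrite !adj_irr.
- exact: hv.
- by rewrite adj_sym hv // adj_sym.
Qed.

(** * Paths *)

Lemma indecT (T : finType) (G : graph T) : indecomposable G = indec G setT.
Proof.
apply/forallP/indecP => [indG I _ mI | indG J].
- have := indG I; rewrite implybE => /orP[/negP[]|].
    apply/forall_inP => v; rewrite inE => vI.
    case: (boolP [forall x in I, adj G v x]) => //=.
    rewrite negb_forall_in => /exists_inP[x xI nvx].
    by apply/forall_inP => y yI; rewrite -(mI v x y).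
  case/or3P => [/eqP->|/eqP->|/existsP[z /eqP->]]; [left|by right|left].
    by move=> x y; rewrite inE.
  by move=> x y; rewrite !inE => /eqP-> /eqP->.
- apply/implyP => /forall_inP mJ; rewrite /trivial_set.
  have [||J1|->] := indG J; first exact: subsetT.
  + move=> v x y _ vJ xJ yJ; have := mJ v; rewrite inE => /(_ vJ).
    case/orP => /forall_inP h; first by rewrite !h.
    by rewrite (negPf (h x xJ)) (negPf (h y yJ)).
  + have [->|[z zJ]] := set_0Vmem J; first by rewrite eqxx.
    apply/or3P/Or33/existsP; exists z; apply/eqP/setP => t; rewrite inE.
    by apply/idP/eqP => [tJ|->//]; apply: J1.
  + by rewrite eqxx orbT.
Qed.

Definition consecutive (i j : nat) := (i == j.+1) || (j == i.+1).

Section Paths.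
Variables (T : finType) (G : graph T).
Implicit Types (f : nat -> T) (k : nat).

(** A path is a function on [nat] read below [k]: shortening changes only [k], and reversal is a
    reindexing. *)
Definition path_set f k := [set f i | i : 'I_k].

Lemma path_setP f k x : reflect (exists2 i, i < k & x = f i) (x \in path_set f k).
Proof.
apply: (iffP imsetP) => [[i _ ->]|[i ik ->]]; first by exists i.
by exists (Ordinal ik).
Qed.

Lemma mem_path_set f k i : i < k -> f i \in path_set f k.
Proof. by move=> ik; apply/path_setP; exists i. Qed.

Lemma path_setS f k : path_set f k.+1 = f k |: path_set f k.
Proof.
apply/setP => x; rewrite in_setU1; apply/path_setP/orP => [[i + ->]|].
  by rewrite ltnS leq_eqVlt => /orP[/eqP->|ik]; [left | right; apply: mem_path_set].
by case=> [/eqP->|/path_setP[i ik ->]]; [exists k | exists i; rewrite // ltnS ltnW].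
Qed.

Definition is_path f k :=
  (forall i j, i < k -> j < k -> f i = f j -> i = j) /\
  (forall i j, i < k -> j < k -> adj G (f i) (f j) = consecutive i j).

Lemma is_pathW f k l : l <= k -> is_path f k -> is_path f l.
Proof.
move=> lk [inj ad]; split=> i j il jl; first by apply: inj; apply: leq_trans lk.
by apply: ad; apply: leq_trans lk.
Qed.

Lemma is_path_rev f k : is_path f k -> is_path (fun i => f (k - i.+1)) k.
Proof.
move=> [inj ad]; split=> i j ik jk; first by move/inj => h; lia.
rewrite ad; [|lia|lia]; rewrite /consecutive; lia.
Qed.

Lemma path_set_rev f k : path_set (fun i => f (k - i.+1)) k = path_set f k.
Proof.
apply/setP => x; apply/path_setP/path_setP => -[i ik ->]; exists (k - i.+1); try lia.
  by [].
by congr f; lia.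
Qed.

Lemma card_path_set f k : is_path f k -> #|path_set f k| = k.
Proof.
move=> [inj _]; rewrite card_imset ?card_ord // => i j /inj h; apply: val_inj.
exact: h.
Qed.

Lemma indec_path4 f : is_path f 4 -> indec G (path_set f 4).
Proof.
move=> [inj ad]; apply/indecP => I sI mI.
have K i j l : i < 4 -> j < 4 -> l < 4 -> consecutive i j != consecutive i l ->
    f j \in I -> f l \in I -> f i \in I.
  move=> i4 j4 l4 ne jI lI; apply: contraNT ne => iI; rewrite -!ad //.
  by apply/eqP/mI => //; apply: mem_path_set.
(* Each pair of vertices of P_4 is separated by a third one, which then belongs to the interval.
   Closing any pair under these six rules gives all four vertices. *)
have K01 := K 2 0 1 isT isT isT isT; have K02 := K 3 0 2 isT isT isT isT.
have K03 := K 1 0 3 isT isT isT isT; have K12 := K 0 1 2 isT isT isT isT.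
have K13 := K 0 1 3 isT isT isT isT; have K23 := K 1 2 3 isT isT isT isT.
have H : forall a b c d : bool, (a -> b -> c) -> (a -> c -> d) -> (a -> d -> b) ->
    (b -> c -> a) -> (b -> d -> a) -> (c -> d -> b) ->
    [&& a, b, c & d] || (a + b + c + d <= 1).
  by move=> [] [] [] [] //= h1 h2 h3 h4 h5 h6; lia.
have /orP[full|] := H _ _ _ _ K01 K02 K03 K12 K13 K23.
  right; apply/eqP; rewrite eqEsubset sI; apply/subsetP => _ /path_setP[i i4 ->].
  by case/and4P: full; case: i i4 => [|[|[|[|]]]].
move=> small; left=> x y xI yI; have /path_setP[i i4 xE] := subsetP sI x xI.
have /path_setP[j j4 yE] := subsetP sI y yI; rewrite xE yE in xI yI *; congr f.
move: i j i4 j4 xI yI small {xE yE} => [|[|[|[|?]]]] [|[|[|[|?]]]] // _ _ -> ->;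
  by do 2!case: (_ \in I).
Qed.

Lemma indec_path f k : 3 < k -> is_path f k -> indec G (path_set f k).
Proof.
elim: k => // k IH; rewrite ltnS leq_eqVlt => /orP[/eqP<-|k3 pf]; first exact: indec_path4.
have [inj ad] := pf.
have pf' := is_pathW (leqnSn k) pf; have ind := IH k3 pf'.
have fk : f k \notin path_set f k.
  by apply/path_setP => -[i ik /inj E]; have := E (ltnSn k) (ltnW ik); lia.
rewrite path_setS; have [//|[[u|] hb]] := indecU1 ind fk; exfalso.
- case: hb => /path_setP[i ik ->] h.
  have K j : j < k -> j != i -> consecutive k j = consecutive i j.
    move=> jk ji; rewrite -!ad; try lia; apply: h; first exact: mem_path_set.
    by apply: contra ji => /eqP/inj E; apply/eqP/E; lia.
  (* A twin of [f (k - 1)] is separated from it by [f (k - 2)]. Otherwise [f (k - 1)] forces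
     [i = k - 2], and [f (k - 3)] separates. *)
  have [ki|ki] := eqVneq i k.-1.
    have := K (k - 2); rewrite /consecutive; lia.
  have := K (k - 1); have := K (k - 3); rewrite /consecutive; lia.
- have := hb (f 0) (f k.-1) (mem_path_set f _) (mem_path_set f _).
  rewrite !ad /consecutive; lia.
Qed.
End Paths.

(** * The structure of the outside graph *)

Section Outside.
Variables (T : finType) (G : graph T) (X : {set T}).
Implicit Types (x y z u v w s t : T).
Local Notation adj := (adj G).
Local Notation indec := (indec G).
Hypotheses (indX : indec X) (X3 : 2 < #|X|).
Hypothesis hasb : forall z, z \notin X -> exists b, in_block G X b z.

(** The default [None] is not reached for an outside vertex, by [hasb]. *)
Definition block z := odflt None [pick b | in_blockb G X b z].

Lemma blockP z : z \notin X -> in_block G X (block z) z.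
Proof.
move=> /hasb[b /in_blockP hb]; rewrite /block; case: pickP => [c /in_blockP //|].
by move=> /(_ b); rewrite hb.
Qed.

Lemma block_uniq b z : in_block G X b z -> block z = b.
Proof.
move=> hb; rewrite /block; case: pickP => [c /in_blockP hc|/(_ b)].
  exact: in_block_uniq hc hb.
by move/in_blockP: hb => ->.
Qed.

(* The adjacency between [x] and [w] if adding [w] to [X] leaves [x] in its
   block; by [block_edge], the edges of [G_X] are the failures of [std]. *)
Definition expected x w := if block x is Some u then adj u w else [exists p in X, adj x p].

Definition std x w := adj x w == expected x w.

Lemma std_block x w : x \notin X -> w \notin X ->
  reflect (in_block G (w |: X) (block x) x) (std x w).
Proof.
move=> xX wX; have := blockP xX; rewrite /std /expected; case: (block x) => [u [uX hu]|h].
  apply: (iffP eqP) => [E|[_]]; last first.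
    by apply; [rewrite !inE eqxx | apply: contraNneq wX => ->].
  split=> [|z]; first by rewrite !inE uX orbT.
  by rewrite !inE => /orP[/eqP->|/hu].
have E p : p \in X -> [exists p in X, adj x p] = adj x p.
  move=> pX; apply/existsP/idP => [[t /andP[tX]]|xp]; first by rewrite (h t p).
  by exists p; rewrite pX.
apply: (iffP eqP) => [E'|H]; have [p [q [pX _ _]]] := card_gt1P (ltnW X3).
  have K r : r \in w |: X -> adj x r = adj x p.
    by rewrite !inE => /orP[/eqP->|rX]; [rewrite E' (E p) | apply: h].
  by move=> s t /K-> /K->.
by rewrite (E p) //; apply: H; rewrite !inE ?pX ?eqxx ?orbT.
Qed.

(** For outside vertices this means lying in the same member of q_X^- or q_X^+. It is finer than
    having the same block, as it separates X^- from X^+ and X^-(u) from X^+(u). *)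
Definition twins x y := forall a, a \in X -> adj x a = adj y a.

Lemma twins_sym x y : twins x y -> twins y x.
Proof. by move=> h a aX; rewrite h. Qed.

Lemma twins_trans x y z : twins x y -> twins y z -> twins x z.
Proof. by move=> h h' a aX; rewrite h ?h'. Qed.

Lemma twins_block x y : x \notin X -> twins x y -> block x = block y.
Proof. by move=> xX h; symmetry; apply/block_uniq/(in_block_eq h)/blockP. Qed.

Lemma twins_expected x y w : x \notin X -> twins x y -> expected x w = expected y w.
Proof.
move=> xX h; rewrite /expected (twins_block xX h); case: (block y) => //.
by apply: eq_existsb => a; apply: andb_id2l => /h.
Qed.

(** Twins expect the same adjacency to [w], so [w] separates them exactly when [std] fails for one
    of them only. *)
Lemma twins_adj x y w : x \notin X -> twins x y ->
  (adj w x == adj w y) = (std x w == std y w).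
Proof.
move=> xX h; rewrite /std (twins_expected w xX h) ![adj w _]adj_sym.
by case: (adj x w); case: (adj y w); case: (expected y w).
Qed.

Lemma expected_twins w x y : w \notin X -> x \notin X -> y \notin X ->
  twins x y -> expected w x = expected w y.
Proof.
move=> wX xX yX h; have := blockP wX; rewrite /expected; case: (block w) => // u [uX _].
by rewrite adj_sym h // adj_sym.
Qed.

(** [w] expects the same adjacency to both twins and conforms to it, so it does not separate
    them. *)
Lemma std_twins w x y : w \notin X -> x \notin X -> y \notin X ->
  twins x y -> std w x -> std w y -> std x w = std y w.
Proof.
move=> wX xX yX h /eqP wx /eqP wy;
have := twins_adj w xX h; rewrite wx wy (expected_twins wX xX yX h) eqxx => /esym/eqP; exact.

Qed.

Definition edge x y := indec (x |: (y |: X)).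

Lemma edge_sym x y : edge x y = edge y x.
Proof. by rewrite /edge setUCA. Qed.

Lemma edge_block x y : x \notin X -> y \notin X -> edge x y -> block x <> block y.
Proof.
move=> xX yX exy E; have hy := blockP yX; rewrite -E in hy.
by move/negP: (same_block_not_indecU2 (ltnW X3) xX yX (blockP xX) hy).
Qed.

Lemma block_edge x y : x \notin X -> y \notin X -> block x <> block y ->
  edge x y = ~~ std x y.
Proof.
move=> xX yX bxy; have xy : x != y by apply/eqP => E; apply: bxy; rewrite E.
apply/idP/idP => [|nstd].
  apply: contraL => /(std_block xX yX) h; apply: in_block_not_indecU2 h _ => //.
    exact: ltnW.
  by have := blockP xX; case: (block x) => // u [uX _] [E]; rewrite -E uX in yX.
apply: indecU2 (blockP xX) (blockP yX) _ => //.
by move/(std_block xX yX); apply/negP.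
Qed.

Lemma edge_std x y : x \notin X -> y \notin X -> edge x y -> std x y = false.
Proof. by move=> xX yX exy; apply/negbTE; rewrite -block_edge //; apply: edge_block. Qed.

(** Inside one block [std] can be asymmetric: a vertex of X^- expects a non-edge to a vertex of X^+,
    which expects an edge. Twins expect the same thing of each other. *)
Lemma std_sym x y : x \notin X -> y \notin X -> twins x y -> std x y = std y x.
Proof.
move=> xX yX txy; rewrite /std adj_sym; congr (_ == _).
rewrite (twins_expected y xX txy); have := blockP yX.
rewrite /expected; case: (block y) => [u [uX _]|//].
by rewrite adj_sym -txy // adj_sym.
Qed.

(** For indices of different parity, [op_std] says that G_X is P_5; for equal parity, it says that
    the colour class, contained in one member of q_X^- or q_X^+ by [op_twins], induces an empty or a
    complete graph. *)
Record outside_path (o : nat -> T) : Prop := OutsidePath {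
  op_notin : forall i, i < 5 -> o i \notin X;
  op_inj : forall i j, i < 5 -> j < 5 -> o i = o j -> i = j;
  op_twins : forall i j, i < 5 -> j < 5 -> odd i = odd j -> twins (o i) (o j);
  op_block : forall i j, i < 5 -> j < 5 -> odd i != odd j -> block (o i) <> block (o j);
  op_std : forall i j, i < 5 -> j < 5 -> i != j -> std (o i) (o j) = ~~ consecutive i j }.

(** * The shape of G_X when no third vertex extends an edge *)

Section NoExtension.
Hypothesis noext : forall x y z, x \notin X -> y \notin X -> z \notin X -> edge x y ->
  z != x -> z != y -> ~~ indec (z |: (x |: (y |: X))).

(** [z] lies in a block of the indecomposable set [x |: (y |: X)]. The blocks of [x] and [y] give
    the last two alternatives; every other block restricts to the block of [z] over [X], so [z]
    conforms to its expectation on both [x] and [y]. *)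
Lemma edge_third x y z :
  x \notin X -> y \notin X -> z \notin X -> edge x y -> z != x -> z != y ->
  [\/ std z x /\ std z y, twins z x /\ adj z y = adj x y | twins z y /\ adj z x = adj y x].
Proof.
move=> xX yX zX exy zx zy; have zW : z \notin x |: (y |: X) by rewrite !inE !negb_or zx zy.
have xy : x <> y by move=> E; apply: (edge_block xX yX exy); rewrite E.
have [d hd] := indecU1P exy zW (noext xX yX zX exy zx zy).
have [dx|dx] := eqVneq d (Some x).
  apply: Or32; move: hd; rewrite dx => -[_ h]; split.
    by move=> a aX; apply: h; rewrite ?inE ?aX ?orbT //; apply: contraNneq xX => <-.
  by apply: h; rewrite ?inE ?eqxx ?orbT // eq_sym; apply/eqP.
have [dy|dy] := eqVneq d (Some y).
  apply: Or33; move: hd; rewrite dy => -[_ h]; split.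
    by move=> a aX; apply: h; rewrite ?inE ?aX ?orbT //; apply: contraNneq yX => <-.
  by apply: h; rewrite ?inE ?eqxx ?orbT //; apply/eqP.
have dX u : d = Some u -> u \in X.
  move=> du; have : u \in x |: (y |: X) by move: hd; rewrite du => -[].
  rewrite !inE => /or3P[/eqP ux|/eqP uy|//]; first by rewrite du ux eqxx in dx.
  by rewrite du uy eqxx in dy.
have sX : X \subset x |: (y |: X) by rewrite setUA subsetUr.
apply: Or31; have E := block_uniq (in_blockS sX hd dX).
split; apply/std_block; rewrite // E; apply: in_blockS hd _.
- by rewrite subUset sub1set setUA subsetUr !inE eqxx.
- by move=> u /dX uX; rewrite inE uX orbT.
- by rewrite subUset sub1set setUA subsetUr !inE eqxx orbT.
- by move=> u /dX uX; rewrite inE uX orbT.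
Qed.

(** The edge between [y] and [z] rules out the alternatives of [edge_third] in which [z] is standard
    with [y] or a twin of [y]. *)
Lemma edge_path x y z :
  x \notin X -> y \notin X -> z \notin X -> edge x y -> edge y z -> z != x -> twins z x.
Proof.
move=> xX yX zX exy eyz zx.
have zy : z != y by apply/eqP => E; apply: (edge_block yX zX eyz); rewrite E.
case: (edge_third xX yX zX exy zx zy) => [[_ szy]|[]//|[/(twins_block zX)]].
  by rewrite edge_std // edge_sym in szy.
by move=> E; case: (edge_block yX zX eyz).
Qed.

(** In [edge_third], a twin [z] of [x] with the same adjacency to [y] would form an edge with [y] as
    [x] does, and a twin of [y] would be in the wrong block. *)
Lemma edge_std_far x y z :
  x \notin X -> y \notin X -> z \notin X -> edge x y -> z != x -> block z = block x ->
  ~~ edge z y -> std z x.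
Proof.
move=> xX yX zX exy zx bzx nzy.
have bxy := edge_block xX yX exy.
have zy : z != y by apply/eqP => E; apply: bxy; rewrite -bzx E.
have bzy : block z <> block y by rewrite bzx.
case: (edge_third xX yX zX exy zx zy) => [[]//|[tzx E]|[tzy _]].
  have := twins_adj y zX tzx; rewrite ![adj y _]adj_sym E eqxx => /esym/eqP.
  by rewrite (edge_std xX yX exy); move: nzy; rewrite block_edge // negbK => ->.
by case: bzy; apply: twins_block.
Qed.

Hypothesis indV : indec setT.

(** A class of at least two twins is not an interval of the indecomposable G. Its separating vertex
    cannot lie in [X], by the definition of twins. *)
Lemma twin_class (M : {set T}) x y : x \in M -> y \in M -> x != y ->
  (forall s, s \in M -> s \notin X /\ twins s x) ->
  exists s t w, [/\ s \in M, t \in M, w \notin M, w \notin X & std s w != std t w].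
Proof.
move=> xM yM xy hM.
have [/existsP[s /existsP[t /existsP[w /and5P[]]]]|none] :=
  boolP [exists s, exists t, exists w, [&& s \in M, t \in M, w \notin M, w \notin X & std s w != std t w]].
  by exists s, t, w.
exfalso; have [||M1|MT] := elimT (indecP G setT) indV M; first exact: subsetT.
- move=> v s t _ vM sM tM; have [sX sx] := hM s sM; have [tX tx] := hM t tM.
  have st := twins_trans sx (twins_sym tx).
  have [vX|vX] := boolP (v \in X); first by rewrite adj_sym [RHS]adj_sym; apply: st.
  apply/eqP; rewrite twins_adj //; apply: contraNT none => ne.
  apply/existsP; exists s; apply/existsP; exists t; apply/existsP; exists v.
  by rewrite sM tM vM vX.
- by case/eqP: xy; apply: M1.
- have [p [q [pX _ _]]] := card_gt1P (ltnW X3).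
  by have := hM p; rewrite MT inE pX => /(_ isT)[].
Qed.

Lemma twins_split x y : x \notin X -> y \notin X -> x != y -> twins x y ->
  exists w, [/\ w \notin X, w != x, w != y & std x w != std y w].
Proof.
move=> xX yX xy txy.
have hM s : s \in [set x; y] -> s \notin X /\ twins s x.
  by rewrite !inE => /orP[]/eqP->; split=> //; apply: twins_sym.
have [s [t [w [sM tM wM wX ne]]]] := twin_class (set21 x y) (set22 x y) xy hM.
move: wM; rewrite !inE negb_or => /andP[wx wy]; exists w; split=> //.
move: sM tM ne; rewrite !inE => /orP[]/eqP-> /orP[]/eqP->; rewrite ?eqxx //.
by rewrite eq_sym.
Qed.

(** An isolated vertex of G_X is standard with every outside vertex of another block, and with the
    non-isolated ones of its own block by [edge_std_far]. So the isolated vertices of one block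
    produce a nontrivial interval of G. *)
Lemma edge_ex z : z \notin X -> exists2 y, y \notin X & edge z y.
Proof.
move=> zX.
pose iso t := (t \notin X) && [forall y, (y \notin X) ==> ~~ edge t y].
have isoP t : iso t -> t \notin X /\ forall y, y \notin X -> ~~ edge t y.
  by case/andP => -> /forallP h; split=> // y; apply/implyP.
have nisoP t : t \notin X -> ~~ iso t -> exists2 y, y \notin X & edge t y.
  by rewrite /iso => -> /= /forallPn[y]; rewrite negb_imply negbK => /andP[]; exists y.
have [ziso|/nisoP] := boolP (iso z); last exact.
have iso_std t w : iso t -> w \notin X -> t != w -> block t = block w -> ~~ iso w -> std t w.
  move=> /isoP[tX nt] wX tw bE /(nisoP w wX)[y yX ewy].
  by apply: edge_std_far ewy _ _ _ => //; apply: nt.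
have iso_std' t w : iso t -> w \notin X -> block t <> block w -> std t w.
  by move=> /isoP[tX nt] wX bE; have := nt w wX; rewrite block_edge // negbK.
have [p [q [pX qX pq]]] := card_gt1P (ltnW X3).
exfalso; have := blockP zX; case bz: (block z) => [u|] => [[uX hu]|hz].
- pose M := u |: [set t | iso t & block t == Some u].
  have MP t : t \in M -> t = u \/ iso t /\ block t = Some u.
    by rewrite !inE => /orP[/eqP|/andP[? /eqP]]; [left | right].
  have [||M1|MT] := elimT (indecP G setT) indV M; first exact: subsetT.
  + have K w t : w \notin M -> t \in M -> adj w t = adj w u.
      move=> wM /MP[->//|[ti bt]]; have [tX _] := isoP t ti.
      rewrite adj_sym [RHS]adj_sym; have [wX|wX] := boolP (w \in X).
        have := blockP tX; rewrite bt => -[_]; apply=> //.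
        by apply: contraNneq wM => ->; rewrite !inE eqxx.
      have stw : std t w.
        have [E|/eqP E] := eqVneq (block t) (block w); last exact: iso_std'.
        apply: iso_std => //.
          by apply: contraNneq wM => <-; rewrite !inE ti bt eqxx orbT.
        by apply: contra wM => iw; rewrite !inE iw -E bt eqxx orbT.
      by move: stw; rewrite /std /expected bt => /eqP.
    by move=> w s t _ wM sM tM; rewrite (K w s) // (K w t).
  + have zu : z <> u by move=> E; rewrite E uX in zX.
    by apply: zu; apply: M1; rewrite !inE ?ziso ?bz ?eqxx ?orbT.
  + have : 1 < #|X :\ u| by have := X3; rewrite (cardsD1 u X) uX.
    case/card_gt1P => r [_ [rX _ _]]; move: rX; rewrite !inE => /andP[ru rX].
    by have := in_setT r; rewrite -MT => /MP[/eqP|[/isoP[]]]; rewrite ?(negPf ru) ?rX.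
(* For block [None] the interval is the complement of the isolated vertices, each of which sees all
   or none of it. *)
- pose M := ~: [set t | iso t & block t == None].
  have [||M1|MT] := elimT (indecP G setT) indV M; first exact: subsetT.
  + have K v w : v \notin M -> w \in M -> adj v w = [exists p in X, adj v p].
      rewrite !inE negbK => /andP[iv /eqP bv] hw; have [vX _] := isoP v iv.
      have [wX|wX] := boolP (w \in X).
        have := blockP vX; rewrite bv => h.
        apply/idP/existsP => [vw|[t /andP[tX]]]; last by rewrite (h t w).
        by exists w; rewrite wX.
      have svw : std v w.
        have [E|/eqP E] := eqVneq (block v) (block w); last exact: iso_std'.
        apply: iso_std => //.
          by apply: contraNneq hw => <-; rewrite iv bv.
        by apply: contra hw => ->; rewrite -E bv.
      by move: svw; rewrite /std /expected bv => /eqP.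
    by move=> v s t _ vM sM tM; rewrite (K v s) // (K v t).
  + have inM t : t \in X -> t \in M by move=> tX; rewrite !inE /iso tX.
    by case/eqP: pq; apply: M1; apply: inM.
  + by have := in_setT z; rewrite -MT !inE ziso bz eqxx.
Qed.

Hypothesis card5 : #|~: X| = 5.

Lemma outside_fresh (r : seq T) : size r < 5 -> exists2 g, g \notin X & g \notin r.
Proof.
move=> r5; have [/existsP[g /andP[gX gr]]|none] := boolP [exists g, (g \notin X) && (g \notin r)].
  by exists g.
suff : #|~: X| <= size r by rewrite card5 leqNgt r5.
apply: leq_trans (card_size r); apply/subset_leq_card/subsetP => g; rewrite inE => gX.
by apply: contraNT none => gr; apply/existsP; exists g; rewrite gX.
Qed.

Lemma outside_all (r : seq T) t : uniq r -> size r = 5 -> all [predC X] r -> t \notin X -> t \in r.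
Proof.
move=> ur r5 rX tX; apply: contraT => tr.
suff : size (t :: r) <= #|~: X| by rewrite card5 /= r5.
rewrite -(card_uniqP _) /= ?tr //; apply/subset_leq_card/subsetP => g.
by rewrite !inE => /orP[/eqP->//|/(allP rX)].
Qed.

Lemma edge_neq x y : x \notin X -> y \notin X -> edge x y -> x != y.
Proof. by move=> xX yX /(edge_block xX yX) h; apply/eqP => E; apply: h; rewrite E. Qed.

(** Without isolated vertices, and without two edges sharing an end, G_X would be a perfect matching
    on five vertices. *)
Lemma cherry : exists p x z,
  [/\ p \notin X, x \notin X, z \notin X, x != z & edge x p /\ edge z p].
Proof.
have [a aX _] := outside_fresh (isT : size ([::] : seq T) < 5).
have [b bX ab] := edge_ex aX.
have [c cX] := outside_fresh (isT : size [:: a; b] < 5).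
rewrite !inE negb_or => /andP[ca cb].
have [d dX cd] := edge_ex cX.
have [E|da] := eqVneq d a.
  by subst d; exists a, b, c; split; rewrite 1?eq_sym // edge_sym.
have [E|db] := eqVneq d b.
  by subst d; exists b, a, c; split; rewrite 1?eq_sym.
have dc : d != c by rewrite eq_sym edge_neq.
have [g gX] := outside_fresh (isT : size [:: a; b; c; d] < 5).
rewrite !inE !negb_or => /and4P[ga gb gc gd].
have [n nX gn] := edge_ex gX.
have : n \in [:: a; b; c; d; g].
  apply: outside_all => //=; last by rewrite aX bX cX dX gX.
  have nab := edge_neq aX bX ab.
  by rewrite !inE !negb_or; do ?[apply/andP; split]; rewrite // eq_sym.
rewrite !inE => /or4P[/eqP E|/eqP E|/eqP E|/orP[]/eqP E]; subst n.
- by exists a, b, g; split; rewrite 1?eq_sym // edge_sym.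
- by exists b, a, g; split; rewrite 1?eq_sym.
- by exists c, d, g; split; rewrite 1?eq_sym // edge_sym.
- by exists d, c, g; split; rewrite 1?eq_sym.
- by have := edge_neq gX nX gn; rewrite eqxx.
Qed.

(** If [r] disagreed with [s] and [s'] about [q], then [edge_std_far] would apply through [q], so
    that [r] could not separate the twins [s] and [s']; neither [p] nor [q] separates them
    either. *)
Lemma star_no_split p q s s' r :
  [/\ p \notin X, q \notin X, s \notin X, s' \notin X & r \notin X] ->
  (forall t, t \notin X -> [|| t == p, t == q, t == s, t == s' | t == r]) ->
  [/\ s != s', r != s & r != s'] -> twins s s' -> twins r s ->
  [/\ edge s p, edge s' p & edge r p] -> block q <> block s ->
  edge s q = edge s' q -> edge r q = edge s q.
Proof.
move=> [pX qX sX s'X rX] all5 [ss' rs rs'] tss' trs [sp s'p rp] bqs ess'.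
have [//|ne] := eqVneq (edge r q) (edge s q); exfalso.
have b1 := twins_block rX trs; have b2 := twins_block sX tss'.
have [t [tX ts ts' /eqP]] := twins_split sX s'X ss' tss'; apply.
move: (all5 t tX); rewrite (negPf ts) (negPf ts') /= => /or3P[/eqP->|/eqP->|/eqP->].
- by rewrite !edge_std.
- by apply: negb_inj; rewrite -!block_edge -?b2 // => E; apply: bqs.
have [esq|nsq] := boolP (edge s q).
  have nrq : ~~ edge r q by apply: contraNN ne => ->; rewrite esq.
  apply: std_twins => //; apply: (@edge_std_far _ q) => //; rewrite -?ess' //.
  by rewrite b1.
have erq : edge r q by move: ne; rewrite (negPf nsq); case: edge.
have K u : u \notin X -> u != r -> block u = block r -> ~~ edge u q -> std u r.
  by move=> uX ur bur; apply: edge_std_far.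
by rewrite !K // -?ess' // 1?eq_sym // b1.
Qed.

(** A separator [w] in the block of [x] would have to be a third neighbour of [p], hence a third
    twin. Adding the fifth vertex [q] if it too lies in that block gives a twin class that nothing
    separates. *)
Lemma cherry_separator p x z w :
  [/\ p \notin X, x \notin X, z \notin X & w \notin X] -> x != z -> edge x p -> edge z p ->
  w != x -> w != z -> std x w != std z w -> block w <> block x.
Proof.
move=> [pX xX zX wX] xz xp zp wx wz ne bwx.
have txz : twins x z.
  by apply: (edge_path zX pX xX zp _ xz); rewrite edge_sym.
have bxp := edge_block xX pX xp; have bxz := twins_block xX txz.
have wp : w != p by apply/eqP => E; apply: bxp; rewrite -bwx E.
have wpE : edge w p.
  apply: contraNT ne => nwp; apply/eqP; apply: std_twins => //.
    exact: edge_std_far xp wx bwx nwp.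
  by apply: edge_std_far zp wz _ nwp; rewrite -?bxz.
have twx : twins w x by apply: (edge_path xX pX wX xp _ wx); rewrite edge_sym.
have [q qX] := outside_fresh (isT : size [:: p; x; z; w] < 5).
rewrite !inE !negb_or => /and4P[qp qx qz qw].
have [xp' zp'] : x != p /\ z != p by rewrite !edge_neq.
have all5 t : t \notin X -> [|| t == p, t == q, t == x, t == z | t == w].
  move=> tX; have : t \in [:: p; q; x; z; w].
    apply: outside_all => //=; last by rewrite pX qX xX zX wX.
    by rewrite !inE !negb_or; do ?[apply/andP; split]; rewrite // eq_sym.
  by rewrite !inE.
have [bqx|/eqP bqx] := eqVneq (block q) (block x).
  have eqp : edge q p.
    have [n nX qn] := edge_ex qX; have bqn := edge_block qX nX qn.
    case/or4P: (all5 n nX) => [/eqP<-//|/eqP E|/eqP E|/orP[]/eqP E]; case: bqn; rewrite E //.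
      by rewrite bqx bxz.
    by rewrite bqx.
  have tqx : twins q x by apply: (edge_path xX pX qX xp _ qx); rewrite edge_sym.
  pose M := [set t in [:: q; x; z; w]].
  have ME t : t \in M -> [/\ t \notin X, twins t x & edge t p].
    rewrite !inE => /or4P[]/eqP-> //; split=> //; exact: twins_sym.
  have [|||s [t [v [/ME[sX _ sp] /ME[tX _ tp] vM vX /eqP[]]]]] := @twin_class M x z _ _ xz.
  - by rewrite !inE eqxx orbT.
  - by rewrite !inE eqxx !orbT.
  - by move=> s /ME[].
  have -> : v = p.
    apply/eqP; move: vM (all5 v vX); rewrite !inE !negb_or.
    by move=> /and4P[/negPf-> /negPf-> /negPf-> /negPf->]; rewrite !orbF.
  by rewrite !edge_std.
have tzx := twins_sym txz; have txw := twins_sym twx; have twz := twins_trans twx txz.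
have star s s' r : [/\ s \notin X, s' \notin X & r \notin X] ->
    (forall t, [|| t == p, t == q, t == x, t == z | t == w] ->
       [|| t == p, t == q, t == s, t == s' | t == r]) ->
    [/\ s != s', r != s & r != s'] -> twins s s' -> twins r s ->
    [/\ edge s p, edge s' p & edge r p] -> block q <> block s ->
    edge s q = edge s' q -> edge r q = edge s q.
  move=> [sX s'X rX] sub; apply: (@star_no_split p q) => // t /all5; exact: sub.
(* Two of the three booleans [edge x q], [edge z q], [edge w q] agree, and [star] forces the third
   to agree with them. *)
have [exz|exz] := eqVneq (edge x q) (edge z q).
  have ewx : edge w q = edge x q by apply: star exz.
  pose M := [set t in [:: x; z; w]].
  have ME t : t \in M -> [/\ t \notin X, twins t x, edge t p & edge t q = edge x q].
    by rewrite !inE => /or3P[]/eqP->.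
  have [|||s [t [v [/ME[sX sx sp sq] /ME[tX tx tp tq] vM vX /eqP[]]]]] := @twin_class M x z _ _ xz.
  - by rewrite !inE eqxx.
  - by rewrite !inE eqxx !orbT.
  - by move=> s /ME[].
  have : (v == p) || (v == q).
    move: vM (all5 v vX); rewrite !inE !negb_or.
    by move=> /and3P[/negPf-> /negPf-> /negPf->]; rewrite !orbF.
  case/orP => /eqP->; first by rewrite !edge_std.
  apply: negb_inj; rewrite -!block_edge ?sq ?tq //.
    by rewrite (twins_block tX tx) => E; case: bqx.
  by rewrite (twins_block sX sx) => E; case: bqx.
have nexz := exz; case/eqP: exz; have [ewx|ewx] := eqVneq (edge w q) (edge x q).
  symmetry; apply: (star x w z) => //.
  - by move=> t; case: (t == z); rewrite ?orbT // !orbF.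
  - by rewrite eq_sym wx eq_sym xz eq_sym wz.
have wq : edge w q = edge z q.
  by move: nexz ewx; case: (edge w q) (edge x q) (edge z q) => [] [] [].
apply: (star z w x) => //.
- by move=> t; case: (t == x); rewrite ?orbT // !orbF.
- by rewrite xz eq_sym wz eq_sym wx.
- exact: twins_sym.
- by rewrite -bxz.
Qed.


(** For two vertices of the same colour on P_5, some neighbour of one is not a neighbour of the
    other, so [edge_std_far] makes the pair standard. *)
Lemma outside_pathI a b c d g : all [predC X] [:: a; b; c; d; g] ->
  [/\ edge a b, edge b c, edge c d & edge d g] ->
  [/\ a != c, b != d, c != g & a != g] -> ~~ edge a d -> ~~ edge b g ->
  outside_path (nth a [:: a; b; c; d; g]).
Proof.
move=> /= /and5P[aX bX cX dX /andP[gX _]] [ab bc cd dg] [ac bd cg ag] nad nbg.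
have tac : twins a c by apply: twins_sym; apply: edge_path ab bc _; rewrite // eq_sym.
have tcg : twins c g by apply: twins_sym; apply: edge_path cd dg _; rewrite // eq_sym.
have tbd : twins b d by apply: twins_sym; apply: edge_path bc cd _; rewrite // eq_sym.
have tag := twins_trans tac tcg.
have Bab := edge_block aX bX ab.
have Bac := twins_block aX tac; have Bag := twins_block aX tag; have Bbd := twins_block bX tbd.
have [ba cb dc gd] : [/\ edge b a, edge c b, edge d c & edge g d].
  by rewrite edge_sym ab edge_sym bc edge_sym cd edge_sym.
have sac : std a c by apply: (@edge_std_far c d).
have sgc : std g c by apply: (@edge_std_far c b); rewrite -?Bac -?Bag // 1?eq_sym // edge_sym.
have sag : std a g by apply: (@edge_std_far g d).
have sbd : std b d by apply: (@edge_std_far d g).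
have sca : std c a by rewrite -std_sym.
have scg : std c g by rewrite -(std_sym gX cX (twins_sym tcg)).
have sga : std g a by rewrite -std_sym.
have sdb : std d b by rewrite -std_sym.
have [ad da bg gb] : [/\ std a d, std d a, std b g & std g b].
  have C s t : s \notin X -> t \notin X -> block s <> block t -> ~~ edge s t -> std s t.
    by move=> sX tX bst; rewrite block_edge // negbK.
  have [Bba nda ngb] : [/\ block b <> block a, ~~ edge d a & ~~ edge g b].
    by split; [apply/nesym | rewrite edge_sym | rewrite edge_sym].
  by split; apply: C; rewrite // -?Bbd -?Bag.
have nab := edge_neq aX bX ab; have nbc := edge_neq bX cX bc; have ncd := edge_neq cX dX cd.
have ndg := edge_neq dX gX dg.
have nad' : a != d by apply/eqP => E; apply: Bab; rewrite E -Bbd.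
have nbg' : b != g by apply/eqP => E; apply: Bab; rewrite E -Bag.
split.
- by move=> [|[|[|[|[|?]]]]].
- have U : uniq [:: a; b; c; d; g].
    by rewrite /= !inE !negb_or nab ac nad' ag nbc bd nbg' ncd cg ndg.
  by move=> i j i5 j5 /eqP; rewrite nth_uniq // => /eqP.
- by move=> [|[|[|[|[|?]]]]] [|[|[|[|[|?]]]]] //= _ _ _; first [by [] | apply: twins_sym].
- move=> [|[|[|[|[|?]]]]] [|[|[|[|[|?]]]]] //= _ _ _; rewrite -?Bac -?Bag -?Bbd //; exact/nesym.
- by move=> [|[|[|[|[|?]]]]] [|[|[|[|[|?]]]]] //= _ _ _;
    rewrite /consecutive /=; first [by [] | rewrite edge_std].
Qed.

Lemma outside_path_ex : exists o, outside_path o.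
Proof.
have [p [x [z [pX xX zX xz [xp zp]]]]] := cherry.
(* The separator [w] of the twins [x] and [z] lies in another block, so in G_X it is a neighbour of
   exactly one of them. Calling that one [z] gives the path [x], [p], [z], [w]. *)
have : exists x z w, [/\ x \notin X, z \notin X & w \notin X] /\
    [/\ x != z, edge x p, edge z p, edge z w & ~~ edge x w] /\ w != p.
  have txz : twins x z by apply: (edge_path zX pX xX zp _ xz); rewrite edge_sym.
  have [w [wX wx wz ne]] := twins_split xX zX xz txz.
  have bwx : block w <> block x by apply: cherry_separator xp zp wx wz ne.
  have bxz := twins_block xX txz.
  have wp : w != p by apply: contraNneq ne => ->; rewrite !edge_std.
  have exw : edge x w = ~~ std x w by apply: block_edge => // E; apply: bwx.
  have ezw : edge z w = ~~ std z w by apply: block_edge => // E; apply: bwx; rewrite bxz.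
  have [sx|nsx] := boolP (std x w).
    by exists x, z, w; rewrite exw ezw; move: ne; rewrite sx; case: (std z w).
  by exists z, x, w; rewrite exw ezw eq_sym; move: ne; rewrite (negPf nsx); case: (std z w).
move=> {x z xX zX xz xp zp} [x [z [w [[xX zX wX] [[xz xp zp zw nxw] wp]]]]].
have [px pz wz] : [/\ edge p x, edge p z & edge w z] by split; rewrite edge_sym.
have txz : twins x z by apply: (edge_path zX pX xX zp _ xz); rewrite edge_sym.
have twp : twins w p by apply: (edge_path pX zX wX pz zw wp).
have Bxz := twins_block xX txz; have Bwp := twins_block wX twp.
have Bpx := edge_block pX xX px.
have [y yX] := outside_fresh (isT : size [:: x; p; z; w] < 5).
rewrite !inE !negb_or => /and4P[yx yp yz yw].
have wx : w != x by apply/eqP => E; apply: Bpx; rewrite -Bwp E.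
have sxz : std x z by apply: (@edge_std_far z w).
have swp : std w p by apply: (@edge_std_far p x) => //; rewrite edge_sym.
have all5 t : t \notin X -> t \in [:: y; x; p; z; w].
  move=> tX; apply: outside_all => //=; last by rewrite yX xX pX zX wX.
  have np := (edge_neq pX xX px, edge_neq pX zX pz, edge_neq wX zX wz).
  rewrite !inE !negb_or yx yp yz yw xz np.
  by rewrite [x == p]eq_sym [x == w]eq_sym [p == w]eq_sym [z == w]eq_sym !np wx wp.
have two s t : s \notin X -> t \notin X -> s != t -> twins s t ->
    (forall v, v \in [:: y; x; p; z; w] -> v != s -> v != t -> std s v = std t v) -> False.
  move=> sX tX st tst h; have [v [vX vs vt /eqP[]]] := twins_split sX tX st tst.
  by apply: h => //; apply: all5.
have cross s t : s \notin X -> t \notin X -> block s = block x -> block t = block p ->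
    ~~ edge s t -> std s t.
  move=> sX tX bs bt; rewrite block_edge ?negbK // bs bt; exact/nesym.
(* The fifth vertex [y] completes P_5 when its neighbour is [w] alone or [x] alone. Otherwise two
   twins are left unseparated: [y] and [z] for neighbours [w] and [p], [y] and [x] if [p] is a
   neighbour but [w] is not, [y] and [p] for [x] and [z], [y] and [w] for [z] alone. *)
have [eyw|nyw] := boolP (edge y w).
  have tyz : twins y z by apply: (edge_path zX wX yX zw _ yz); rewrite edge_sym.
  have Byz := twins_block yX tyz.
  have [eyp|nyp] := boolP (edge y p).
    exfalso; apply: (two z y) => //; [by rewrite eq_sym | exact: twins_sym |].
    move=> v; rewrite !inE => /or4P[/eqP->|/eqP->|/eqP->|/orP[]/eqP->]; rewrite ?eqxx // => _ _.
    - apply: std_twins => //; first exact: twins_sym.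
      by apply: (@edge_std_far y w) => //; rewrite 1?eq_sym // Byz.
    - by rewrite !edge_std.
    - by rewrite !edge_std.
  exists (nth x [:: x; p; z; w; y]); apply: outside_pathI.
  - by rewrite /= xX pX zX wX yX.
  - by rewrite xp pz zw edge_sym.
  - by rewrite xz eq_sym wp eq_sym yz eq_sym yx.
  - by [].
  - by rewrite edge_sym.
have [eyp|nyp] := boolP (edge y p).
  have tyx : twins y x by apply: (edge_path xX pX yX xp _ yx); rewrite edge_sym.
  have Byx := twins_block yX tyx.
  exfalso; apply: (two y x) => // v.
  rewrite !inE => /or4P[/eqP->|/eqP->|/eqP->|/orP[]/eqP->]; rewrite ?eqxx // => _ _.
  - by rewrite !edge_std.
  - by rewrite sxz; apply: (@edge_std_far z w) => //; rewrite Byx.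
  - by rewrite !cross.
have nwx : ~~ edge w x by rewrite edge_sym.
have npw : ~~ edge p w by apply/negP => /(edge_block pX wX); rewrite Bwp.
have nyy : ~~ edge y y by apply/negP => /(edge_block yX yX).
have [n nX yn] := edge_ex yX.
have [eyx|nyx] := boolP (edge y x).
  have typ : twins y p by apply: (edge_path pX xX yX px _ yp); rewrite edge_sym.
  have Byp := twins_block yX typ.
  have [eyz|nyz] := boolP (edge y z).
    exfalso; apply: (two p y) => //; [by rewrite eq_sym | exact: twins_sym |].
    move=> v; rewrite !inE => /or4P[/eqP->|/eqP->|/eqP->|/orP[]/eqP->]; rewrite ?eqxx // => _ _.
    - by rewrite !edge_std.
    - by rewrite !edge_std.
    - apply: std_twins => //; first exact: twins_sym.
      by apply: (@edge_std_far y x) => //; rewrite 1?eq_sym // Byp.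
  exists (nth y [:: y; x; p; z; w]); apply: outside_pathI => //.
  - by rewrite /= xX pX zX wX yX.
  - by rewrite eq_sym in wp; rewrite yp xz wp yw.
have eyz : edge y z.
  have := all5 n nX; rewrite !inE => /or4P[/eqP E|/eqP E|/eqP E|/orP[]/eqP E]; move: yn; rewrite E //.
  - by rewrite (negPf nyy).
  - by rewrite (negPf nyx).
  - by rewrite (negPf nyp).
  - by rewrite (negPf nyw).
have typ : twins y p by apply: (edge_path pX zX yX pz _ yp); rewrite edge_sym.
have Byp := twins_block yX typ.
exfalso; apply: (two y w) => //; first exact: twins_trans typ (twins_sym twp).
move=> v; rewrite !inE => /or4P[/eqP->|/eqP->|/eqP->|/orP[]/eqP->]; rewrite ?eqxx // => _ _.
- have C t : t \notin X -> block t = block p -> ~~ edge t x -> std t x.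
    by move=> tX bt; rewrite block_edge ?negbK ?bt.
  by rewrite !C.
- rewrite swp; apply: (@edge_std_far p x) => //.
- by rewrite !edge_std.
Qed.

End NoExtension.
End Outside.

(** * Excluded blocks *)

Lemma cardsCU1 (T : finType) (Z : {set T}) z : z \notin Z -> #|~: (z |: Z)| = #|~: Z|.-1.
Proof.
move=> zZ; have := cardsC (z |: Z); have := cardsC Z; rewrite cardsU1 zZ; lia.
Qed.

Lemma card_swap (T : finType) (Z : {set T}) u v : u \in Z -> v \notin Z ->
  #|v |: (Z :\ u)| = #|Z|.
Proof. by move=> uZ vZ; rewrite cardsU1 !inE negb_and vZ orbT [RHS](cardsD1 u) uZ. Qed.

Lemma cardC_swap (T : finType) (Z : {set T}) u v : u \in Z -> v \notin Z ->
  #|~: (v |: (Z :\ u))| = #|~: Z|.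
Proof.
move=> uZ vZ; rewrite cardsCU1 ?inE ?negb_and ?vZ ?orbT // setCD setUC cardsU1.
by rewrite inE uZ.
Qed.

Section Elimination.
Variables (T : finType) (G : graph T) (X : {set T}) (p q : T).
Implicit Types (x y z u : T) (Z : {set T}).
Local Notation adj := (adj G).
Local Notation indec := (indec G).
Hypotheses (indX : indec X) (X3 : 2 < #|X|) (pX : p \in X) (qX : q \in X).
Hypothesis card5 : #|~: X| = 5.
(** The form in which the covering condition enters; [p] and [q] will be the ends of the path. *)
Hypothesis even_full : forall Z, p \in Z -> q \in Z -> 2 < #|Z| -> indec Z ->
  ~~ odd #|~: Z| -> Z = setT.

Lemma even_not_indec Z : p \in Z -> q \in Z -> #|~: Z| \in [:: 2; 4] -> ~~ indec Z.
Proof.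
move=> pZ qZ Z24; apply/negP => indZ.
have Z3 : 2 < #|Z|.
  by have := cardsC Z; have := cardsC X; move: Z24; rewrite !inE; lia.
have := even_full pZ qZ Z3 indZ; move: Z24.
by rewrite !inE => /orP[]/eqP E; rewrite E => /(_ isT) ZT; rewrite ZT setCT cards0 in E.
Qed.

Lemma outside_block z : z \notin X -> exists b, in_block G X b z.
Proof.
move=> zX; apply: indecU1P => //; apply: even_not_indec; rewrite ?inE ?pX ?qX ?orbT //.
by rewrite cardsCU1 // card5.
Qed.

Lemma no_extension x y z : x \notin X -> y \notin X -> z \notin X -> edge G X x y ->
  z != x -> z != y -> ~~ indec (z |: (x |: (y |: X))).
Proof.
move=> xX yX zX exy zx zy; apply: even_not_indec; rewrite ?inE ?pX ?qX ?orbT //.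
have xy := edge_neq X3 outside_block xX yX exy.
by rewrite !cardsCU1 ?card5 // !inE !negb_or ?zx ?zy ?xy.
Qed.

(* [X1] exchanges [u] for its twin [b1]; either [c1 |: X1] is indecomposable, or
   [c1] and [b2] form an edge of [G_X1] and [c2] extends the resulting set. *)
Lemma inner_block u b1 b2 c1 c2 :
  u \in X -> u != p -> u != q ->
  [/\ b1 \notin X, b2 \notin X, c1 \notin X & c2 \notin X] -> uniq [:: b1; b2; c1; c2] ->
  twins G X b1 b2 -> twins G X c1 c2 -> block G X b1 = Some u -> block G X c1 <> Some u ->
  [/\ ~~ std G X c1 b1, std G X c1 b2, ~~ std G X c2 b2 & std G X c2 b1] -> False.
Proof.
move=> uX up uq [b1X b2X c1X c2X] uniq4 tb tc bb bc [s11 s12 s22 s21].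
move: uniq4; rewrite /= !inE !negb_or => /and4P[/and3P[b12 b1c1 b1c2] /andP[b2c1 b2c2] c12 _].
have hb1 : in_block G X (Some u) b1 by rewrite -bb; apply: blockP outside_block _ b1X.
have hb2 := in_block_eq tb hb1.
set X1 := b1 |: (X :\ u).
have indX1 : indec X1 by apply: indec_swap hb1.
have cX1 : #|~: X1| = 5 by rewrite cardC_swap.
have X1_3 : 2 < #|X1| by rewrite card_swap.
have nX1 z : z \notin X -> z != b1 -> z \notin X1.
  by move=> zX zb; rewrite !inE !negb_or zb /= negb_and zX orbT.
have XX1 z : z \in X -> z != u -> z \in X1 by move=> zX zu; rewrite !inE zu zX orbT.
have [pX1 qX1] : p \in X1 /\ q \in X1 by rewrite !XX1 // eq_sym.
have b2X1 : b2 \notin X1 by apply: nX1; rewrite // eq_sym.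
have c1X1 : c1 \notin X1 by apply: nX1; rewrite // eq_sym.
have c2X1 : c2 \notin X1 by apply: nX1; rewrite // eq_sym.
have X1u z : z \in X1 -> z != b1 -> z \in X /\ z != u.
  by move=> + zb; rewrite !inE (negPf zb) /= => /andP[].
have sep : adj c1 b1 != adj c1 b2.
  move: s11 s12; rewrite /std (expected_twins outside_block c1X b1X b2X tb) => ne /eqP->.
  exact: ne.
have [d hd] : exists d, in_block G X1 d c1.
  apply: indecU1P => //; apply: even_not_indec; [exact: setU1r | exact: setU1r |].
  by rewrite cardsCU1 // cX1.
have db1 : Some b1 <> d.
  move=> E; apply: bc; apply: block_uniq => //; split=> // z zX zu.
  case: hb1 hd => _ hb1; rewrite -E => -[_ h]; rewrite -hb1 //; apply: h; first exact: XX1.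
  by apply: contraNneq b1X => <-.
have twin_b z : z \in X1 -> z != b1 -> adj b2 z = adj b1 z.
  move=> zX1 zb; have [zX _] := X1u z zX1 zb; by rewrite tb.
have b1X1 : b1 \in X1 by rewrite !inE eqxx.
have hb2' : in_block G X1 (Some b1) b2 by [].
(* [c1] separates [b1] from [b2], so adding [c1] removes [b2] from the block of [b1] over [X1]. *)
have indX2 : indec (b2 |: (c1 |: X1)).
  apply: indecU2 hb2' hd _ => // -[_ /(_ c1)]; rewrite !inE eqxx => /(_ isT).
  rewrite eq_sym => /(_ b1c1) E; case/eqP: sep.
  by rewrite adj_sym [RHS]adj_sym E.
set X2 := b2 |: (c1 |: X1) in indX2 *.
have X12 : X1 \subset X2 by rewrite /X2 setUA subsetUr.
have c2X2 : c2 \notin X2.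
  by rewrite in_setU1 in_setU1 !negb_or c2X1 [c2 == b2]eq_sym b2c2 [c2 == c1]eq_sym c12.
have [e he] : exists e, in_block G X2 e c2.
  apply: indecU1P => //; apply: even_not_indec.
  - by do 3!apply: setU1r.
  - by do 3!apply: setU1r.
  - have b2n : b2 \notin c1 |: X1 by rewrite in_setU1 negb_or b2X1 b2c1.
    by rewrite (cardsCU1 c2X2) (cardsCU1 b2n) (cardsCU1 c1X1) cX1.
have bcE := twins_block indX X3 outside_block c1X tc.
have bX v : block G X c2 = Some v -> v \in X /\ v != u.
  move=> E; have := blockP outside_block c2X; rewrite E => -[vX _]; split=> //.
  by apply: contra_notN bc => /eqP <-; rewrite bcE.
have hc2 : in_block G X1 (block G X c2) c2.
  have h := elimT (std_block X3 outside_block c2X b1X) s21.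
  apply: in_blockS h _; first by apply: setUS; apply: subD1set.
  by move=> v /bX[vX vu]; apply: XX1.
have uniqX1 d' e' z := @in_block_uniq _ G X1 d' e' z indX1 X1_3.
have b2X2 : b2 \in X2 by rewrite !inE eqxx.
case/negP: s22; apply/(std_block X3 outside_block c2X b2X).
have hX := blockP outside_block c2X.
(* No block over [X2] suits [c2]: a twin of [b2] would be a twin of [b1] over [X1], against [hc2]; a
   twin of [c1] is excluded by [b1]; the other blocks make [c2] standard with [b2]. *)
case: e he => [w [wX2 he]|he]; last first.
  have E : block G X c2 = None by apply: uniqX1 hc2 _; apply: in_blockS he _.
  rewrite E in hX *.
  have K r : r \in b2 |: X -> adj c2 r = adj c2 p.
    rewrite in_setU1 => /orP[/eqP->|rX]; last exact: hX.
    by apply: he => //; apply: (subsetP X12).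
  by move=> r r' /K-> /K->.
have := wX2; rewrite in_setU1 in_setU1 => /or3P[/eqP wb|/eqP wc|wX1].
- suff E : block G X c2 = Some b1 by case: (bX _ E); rewrite (negPf b1X).
  apply: uniqX1 hc2 _; split=> // z zX1 zb.
  rewrite -twin_b //; subst w; apply: he; first exact: (subsetP X12).
  by apply: contraNneq b2X1 => <-.
- subst w; have := he b1 (subsetP X12 b1 b1X1) b1c1.
  have := twins_adj indX X3 outside_block b1 c1X tc; rewrite s21 (negPf s11).
  by move=> /eqP ne E; case: ne; rewrite adj_sym -E adj_sym.
- have E : block G X c2 = Some w.
    by apply: uniqX1 hc2 _; split=> // z zX1; apply: he; apply: (subsetP X12).
  have [wX wu] := bX _ E; rewrite E in hX *; split=> [|z]; first by rewrite inE wX orbT.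
  rewrite in_setU1 => /orP[/eqP->|zX]; first exact: he.
  by case: hX => _; apply.
Qed.
End Elimination.

(** * Blocks at the two ends of the path *)

Section PathEnds.
Variables (T : finType) (G : graph T).
Implicit Types (f : nat -> T) (b c s t x : T) (Z : {set T}).
Local Notation adj := (adj G).
Local Notation indec := (indec G).

Lemma card_path_setC f k : is_path G f k -> #|~: path_set f k| = #|T| - k.
Proof. by move=> pf; rewrite -(cardsC (path_set f k)) (card_path_set pf) addKn. Qed.

Lemma notin_path_set f k l x : k <= l -> x \notin path_set f l -> x \notin path_set f k.
Proof.
move=> kl; apply: contraNN => /path_setP[i ik ->]; apply: mem_path_set.
exact: leq_trans kl.
Qed.

(** [s] stands for a vertex of the path beyond the first [k]. First [b] and [c] extend the shortened
    path; then no block is left for [s]: [None] is excluded by [c] and [f 0], a twin of [b] by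
    [f 1], a twin of [c] by the last hypothesis, and a twin in the path by the uniqueness of
    blocks. *)
Lemma indec_end_extension f k b c s :
  3 < k -> is_path G f k ->
  [/\ b \notin path_set f k, c \notin path_set f k & s \notin path_set f k] ->
  [/\ b != c, s != b & s != c] ->
  in_block G (path_set f k) (Some (f 0)) b -> in_block G (path_set f k) None c ->
  in_block G (path_set f k) None s ->
  [/\ adj s (f 0) = false, adj s b = false & adj s c] -> adj c b != adj c (f 0) ->
  indec (s |: (b |: (c |: path_set f k))).
Proof.
move=> k3 pf [bZ cZ sZ] [bc sb sc] hb hc hs [s0 sbF scT] cb.
have [inj ad] := pf; have indZ := indec_path k3 pf.
have Z3 : 2 < #|path_set f k| by rewrite (card_path_set pf) ltnW.
have f0Z : f 0 \in path_set f k by apply: mem_path_set; apply: leq_ltn_trans k3.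
have k1 : 1 < k by apply: leq_trans k3.
have k0 := ltnW k1.
have f1Z : f 1 \in path_set f k by apply: mem_path_set.
have c0 : c != f 0 by apply: contraNneq cZ => ->.
have indY : indec (b |: (c |: path_set f k)).
  apply: indecU2 hb hc _ => // -[_ /(_ c)]; rewrite in_setU1 eqxx => /(_ isT c0) E.
  by case/eqP: cb; rewrite adj_sym E adj_sym.
have sY : s \notin b |: (c |: path_set f k) by rewrite !in_setU1 !negb_or sb sc.
have bY : b \in b |: (c |: path_set f k) by rewrite setU11.
have cY : c \in b |: (c |: path_set f k) by rewrite setU1r // setU11.
have inY z : z \in path_set f k -> z \in b |: (c |: path_set f k).
  by move=> zZ; do 2!apply: setU1r.
have [//|[[u|] hu]] := indecU1 indY sY; last first.
  by have := hu c (f 0) cY (inY _ f0Z); rewrite scT s0.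
case: hu => uY hu; exfalso; move: (uY); rewrite !in_setU1 => /or3P[/eqP ub|/eqP uc|uZ].
- have b1 : adj b (f 1) by case: hb => _ ->; rewrite ?ad //; apply/eqP => /(inj _ _ k1 k0).
  have s1 : adj s (f 1) = false by rewrite (hs _ (f 0)).
  have : f 1 != b by apply: contraNneq bZ => <-.
  by rewrite -ub => /(hu _ (inY _ f1Z)); rewrite s1 ub b1.
- have f0c : f 0 != c by rewrite eq_sym.
  rewrite uc in hu; have := hu b bY bc; have := hu _ (inY _ f0Z) f0c.
  by rewrite s0 sbF => c0F cbF; rewrite -c0F -cbF in cb.
- have : Some u = None; last by [].
  apply: in_block_uniq indZ Z3 _ hs; split=> // z zZ zu; exact: hu (inY z zZ) zu.
Qed.

Variables (m : nat).
Hypotheses (m9 : 8 < m) (cardT : #|T| = m + 5).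
(** Kept as a predicate of [f] because it is also applied to the reversed path. *)
Definition ends_full f := forall Z, f 0 \in Z -> f m.-1 \in Z -> 2 < #|Z| -> indec Z ->
  ~~ odd #|~: Z| -> Z = setT.

Section Ends.
Variable f : nat -> T.
Hypotheses (pf : is_path G f m) (full : ends_full f).
Local Notation X := (path_set f m).

Lemma ind_path : indec X. Proof. by apply: indec_path pf; apply: leq_trans m9. Qed.
Lemma card_path3 : 2 < #|X|. Proof. by rewrite (card_path_set pf); apply: leq_trans m9. Qed.
Lemma mem_first : f 0 \in X. Proof. by apply: mem_path_set; apply: leq_ltn_trans m9. Qed.
Lemma mem_last : f m.-1 \in X. Proof. by apply: mem_path_set; move: m9; case: m. Qed.
Lemma card_outside : #|~: X| = 5. Proof. by rewrite (card_path_setC pf) cardT addKn. Qed.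
Hint Resolve ind_path card_path3 mem_first mem_last card_outside : core.

Lemma outside_ex z : z \notin X -> exists d, in_block G X d z.
Proof. exact: (@outside_block _ _ _ (f 0) (f m.-1)). Qed.

Lemma end_not_indec Z : f 0 \in Z -> f m.-1 \in Z -> #|~: Z| = 4 -> ~~ indec Z.
Proof.
move=> pZ qZ Z4; apply: (@even_not_indec _ _ X (f 0) (f m.-1)) => //.
by rewrite Z4.
Qed.

Lemma first_block b k : b \notin X -> block G X b = Some (f 0) -> 0 < k <= m ->
  in_block G (path_set f k) (Some (f 0)) b.
Proof.
move=> bX E /andP[k0 km]; have := blockP outside_ex bX; rewrite E => h.
apply: in_blockS h _; last by move=> _ [<-]; apply: mem_path_set.
by apply/subsetP => _ /path_setP[i ik ->]; apply: mem_path_set; apply: leq_trans km.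
Qed.

(** The last vertex of the path plays [s]; dropping its neighbour [f (m - 2)] detaches it from the
    shortened path. The set obtained has (m - 2) + 3 vertices, which leaves four outside. *)
Lemma end_extension_false b c : b \notin X -> c \notin X ->
  block G X b = Some (f 0) -> in_block G (path_set f (m - 2)) None c ->
  adj c (f m.-1) -> adj c b != adj c (f 0) -> False.
Proof.
move=> bX cX bb hc cm ne; have [inj ad] := pf.
have k3 : 3 < m - 2 by rewrite ltn_subRL; apply: leq_trans m9.
have kpos : 0 < m - 2 by apply: leq_ltn_trans k3.
have km : m - 2 <= m by rewrite leq_subr.
have hb := first_block bX bb (introT andP (conj kpos km)).
have pk := is_pathW km pf.
have k2 : 2 < #|path_set f (m - 2)| by rewrite (card_path_set pk) ltnW.
have bc : b != c.
  by apply/eqP => E; rewrite -E in hc; have := in_block_uniq (indec_path k3 pk) k2 hb hc.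
have [bZ cZ] := (notin_path_set km bX, notin_path_set km cX).
have m0 : 0 < m by apply: leq_ltn_trans m9.
have sZ : f m.-1 \notin path_set f (m - 2).
  by apply/path_setP => -[i im /inj E]; have := E; move: m9 im; clear; lia.
have nX z : z \notin X -> f m.-1 != z by apply: contraNneq => <-.
have hs i : i < m - 2 -> adj (f m.-1) (f i) = false.
  by move=> im; rewrite ad /consecutive; move: im m9; clear; lia.
have hsN : in_block G (path_set f (m - 2)) None (f m.-1).
  by move=> y z /path_setP[i im ->] /path_setP[j jm ->]; rewrite !hs.
have sb : adj (f m.-1) b = false.
  have := blockP outside_ex bX; rewrite bb adj_sym => -[_ ->] //; last first.
    by apply/eqP => /inj; move: m9; clear; lia.
  by rewrite adj_sym hs.
have ind : indec (f m.-1 |: (b |: (c |: path_set f (m - 2)))).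
  apply: (indec_end_extension k3 pk) => //; first by split; rewrite ?nX.
  by rewrite hs // sb adj_sym cm.
move: ind; apply/negP; apply: end_not_indec.
- by do 3!apply: setU1r; apply: mem_path_set.
- exact: setU11.
- have bY : b \notin c |: path_set f (m - 2) by rewrite in_setU1 negb_or bc.
  have sY : f m.-1 \notin b |: (c |: path_set f (m - 2)).
    by rewrite !in_setU1 !negb_or !nX.
  rewrite (cardsCU1 sY) (cardsCU1 bY) (cardsCU1 cZ) (card_path_setC pk) cardT.
  by move: m9; clear; lia.
Qed.

Lemma universal_end b c x : b \notin X -> c \notin X -> x \in X ->
  block G X b = Some (f 0) -> block G X c = None -> adj c x -> ~~ std G X c b -> False.
Proof.
move=> bX cX xX bb bc cx ns; have hc := blockP outside_ex cX; rewrite bc in hc.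
have cT t : t \in X -> adj c t by move=> tX; rewrite (hc t x).
apply: (end_extension_false bX cX bb).
- apply: (in_blockS _ hc) => //.
  by apply/subsetP => _ /path_setP[i ik ->]; exact: mem_path_set (leq_trans ik (leq_subr _ _)).
- exact: cT.
- rewrite (cT (f 0)) //; move: ns; rewrite /std /expected bc.
  suff -> : [exists p in X, adj c p] by [].
  by apply/existsP; exists x; rewrite xX cT.
Qed.

Lemma both_ends b c : b \notin X -> c \notin X ->
  block G X b = Some (f 0) -> block G X c = Some (f m.-1) -> ~~ std G X b c -> False.
Proof.
move=> bX cX bb bc ns; have hc := blockP outside_ex cX; rewrite bc in hc.
have [inj ad] := pf; have m0 : 0 < m by apply: leq_ltn_trans m9.
have cf i : i < m - 1 -> adj c (f i) = (i == m - 2).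
  move=> im; case: hc => _ ->; last 1 first.
  - by apply/eqP => /inj; move: im m9; clear; lia.
  - by rewrite ad /consecutive; move: im m9; clear; lia.
  - by apply: mem_path_set; move: im; clear; lia.
have hcN k : k <= m - 2 -> in_block G (path_set f k) None c.
  move=> km y z /path_setP[i im ->] /path_setP[j jm ->].
  by rewrite !cf; move: im jm km m9; clear; lia.
have c0 : adj c (f 0) = false by rewrite cf; move: m9; clear; lia.
have cb : adj c b.
  move: ns; rewrite /std /expected bb adj_sym [adj (f 0) c]adj_sym c0.
  by case: adj.
have ne : adj c b != adj c (f 0) by rewrite cb c0.
(* If [c] misses the last vertex, then [f (m - 2)] has to play [s], so [f (m - 3)] is dropped to
   detach it. The complement then has five vertices, and adding [f (m - 1)] restores the even
   parity. *)
have [cm|cm] := boolP (adj c (f m.-1)); first exact: end_extension_false (hcN _ _) cm ne.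
have kE : (3 < m - 3) /\ (m - 3 < m - 2) by move: m9; clear; lia.
have [k3 kl] := kE; have km : m - 3 <= m by rewrite leq_subr.
have kpos : 0 < m - 3 by apply: leq_ltn_trans k3.
have hb := first_block bX bb (introT andP (conj kpos km)).
have pk := is_pathW km pf.
have k2 : 2 < #|path_set f (m - 3)| by rewrite (card_path_set pk) ltnW.
have hcZ := hcN _ (ltnW kl).
have nbc : b != c.
  by apply/eqP => E; rewrite -E in hcZ; have := in_block_uniq (indec_path k3 pk) k2 hb hcZ.
have [bZ cZ] := (notin_path_set km bX, notin_path_set km cX).
have fX i z : i < m -> z \notin X -> f i != z.
  by move=> im; apply: contraNneq => <-; apply: mem_path_set.
have fZ i : i < m -> m - 3 <= i -> f i \notin path_set f (m - 3).
  move=> im ki; apply/path_setP => -[j jm /inj E].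
  by move: (E im (leq_trans jm km)) => Eij; move: jm; rewrite -Eij ltnNge ki.
have hs i j : i < m -> m - 2 <= i -> j < m - 3 -> adj (f i) (f j) = false.
  by move=> im ki jk; rewrite ad /consecutive; move: im ki jk m9; clear; lia.
have hsN i : i < m -> m - 2 <= i -> in_block G (path_set f (m - 3)) None (f i).
  by move=> im ki y z /path_setP[j jm ->] /path_setP[l lm ->]; rewrite !hs.
have sb i : i < m -> m - 2 <= i -> adj (f i) b = false.
  move=> im ki; have := blockP outside_ex bX; rewrite bb adj_sym => -[_ ->].
  - by rewrite adj_sym hs.
  - exact: mem_path_set.
  - by apply/eqP => /inj; move: m9 im ki; clear; lia.
have [s1 s2] : m - 2 < m /\ m - 1 < m by move: m9; clear; lia.
have s3 : m - 2 <= m - 1 by move: m9; clear; lia.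
have sc : adj (f (m - 2)) c by rewrite adj_sym cf ?eqxx //; move: m9; clear; lia.
have s_1 : m.-1 = m - 1 by rewrite subn1.
set Z := path_set f (m - 3) in hb k2 hcZ bZ cZ fZ hsN *.
have [sZ tZ] : f (m - 2) \notin Z /\ f (m - 1) \notin Z.
  by split; apply: fZ; move: m9; clear; lia.
have indY : indec (f (m - 2) |: (b |: (c |: Z))).
  apply: (indec_end_extension k3 pk) => //; first by split; rewrite // fX.
    exact: hsN.
  by rewrite hs // sb.
have tY : f (m - 1) \notin f (m - 2) |: (b |: (c |: Z)).
  rewrite !in_setU1 !negb_or (fX _ b) // (fX _ c) // tZ !andbT.
  by apply/eqP => /inj; move: m9; clear; lia.
have Yf : f 0 \in f (m - 2) |: (b |: (c |: Z)) by do 3!apply: setU1r; apply: mem_path_set.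
have Yf1 : f 1 \in f (m - 2) |: (b |: (c |: Z)).
  by do 3!apply: setU1r; apply: mem_path_set; apply: leq_trans k3.
have bY : b \in f (m - 2) |: (b |: (c |: Z)) by apply: setU1r; apply: setU11.
have cY : c \in f (m - 2) |: (b |: (c |: Z)) by do 2!apply: setU1r; apply: setU11.
have sY : f (m - 2) \in f (m - 2) |: (b |: (c |: Z)) by apply: setU11.
have ts : adj (f (m - 1)) (f (m - 2)) by rewrite ad // /consecutive; move: m9; clear; lia.
have tc : adj (f (m - 1)) c = false by rewrite adj_sym -s_1 (negPf cm).
have nind : ~~ indec (f (m - 1) |: (f (m - 2) |: (b |: (c |: Z)))).
  apply: end_not_indec.
  - exact: setU1r.
  - by rewrite s_1 setU11.
  - have sn : f (m - 2) \notin b |: (c |: Z) by rewrite !in_setU1 !negb_or !fX.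
    have bn : b \notin c |: Z by rewrite in_setU1 negb_or nbc.
    rewrite (cardsCU1 tY) (cardsCU1 sn) (cardsCU1 bn) (cardsCU1 cZ) (card_path_setC pk) cardT.
    by move: m9; clear; lia.
have [[u|] hu] := indecU1P indY tY nind; last first.
  by have := hu _ _ sY Yf; rewrite ts hs.
case: hu => uY hu; move: (uY); rewrite !in_setU1 => /or4P[/eqP E|/eqP E|/eqP E|uZ].
- by have := hu c cY; rewrite E tc sc => h; have := h _; rewrite eq_sym fX // => /(_ isT).
- have m31 : 1 < m - 3 by apply: leq_trans k3.
  have := hu (f 1) Yf1; rewrite E hs // => h.
  have m1 : 1 < m by apply: leq_ltn_trans m9.
  have : adj b (f 1).
    have := blockP outside_ex bX; rewrite bb => -[_ ->]; first by rewrite ad.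
      exact: mem_path_set.
    by apply/eqP => /inj; move: m9; clear; lia.
  by rewrite -h // fX.
- by have := hu b bY; rewrite E sb // cb => h; have := h nbc.
- have : Some u = None; last by [].
  apply: (in_block_uniq (indec_path k3 pk) k2 _ (hsN _ s2 s3)); split=> // z zZ zu.
  by apply: hu => //; do 3!apply: setU1r.
Qed.
End Ends.
End PathEnds.

(** * The explicit family *)

(* [0, ..., m - 1] is the path and [m, ..., m + 4] the path of [G_X]; the
   vertices [m + k] with [odd k = par] form [X^-], the others [X^-(1)] or
   [X^+(1)], according to [sgn]. *)
Definition attached (par sgn : bool) k j := (odd k != par) && ((j == 1) || (j == 0) && sgn).

(** A vertex of X^- expects to be adjacent to nothing, so between the two colour classes adjacency
    in G is adjacency in G_X. *)
Definition outer_adj (par sgn : bool) k l :=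
  if odd k == odd l then [&& k != l, odd k != par & sgn] else consecutive k l.

Definition model_adj m (par sgn : bool) i j :=
  if i < m then if j < m then consecutive i j else attached par sgn (j - m) i
  else if j < m then attached par sgn (i - m) j else outer_adj par sgn (i - m) (j - m).

Definition is_model (T : finType) (G : graph T) m par sgn (h : nat -> T) :=
  [/\ #|T| = m + 5, forall i j, i < m + 5 -> j < m + 5 -> h i = h j -> i = j
    & forall i j, i < m + 5 -> j < m + 5 -> adj G (h i) (h j) = model_adj m par sgn i j].

Lemma consecutive_sym i j : consecutive i j = consecutive j i.
Proof. by rewrite /consecutive orbC. Qed.

Lemma consecutive_parity i j : odd i = odd j -> consecutive i j = false.
Proof.
by move=> ij; apply/negP => /orP[]/eqP E; move: ij; rewrite E /=; case: odd.
Qed.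

(** * From the condition on the ends to the explicit family *)

Section ToModel.
Variables (T : finType) (G : graph T) (m : nat).
Hypotheses (m9 : 8 < m) (cardT : #|T| = m + 5) (indV : indec G setT).

Lemma ends_full_rev f : ends_full G m f -> ends_full G m (fun i => f (m - i.+1)).
Proof.
move=> full Z pZ qZ; apply: full; last by rewrite -subn1.
by move: qZ; rewrite prednK ?subnn //; apply: leq_ltn_trans m9.
Qed.

Lemma model_of_outside f o par :
  is_path G f m -> outside_path G (path_set f m) o ->
  (forall z, z \notin path_set f m -> exists d, in_block G (path_set f m) d z) ->
  (forall i, i < 5 -> odd i == par -> forall x, x \in path_set f m -> adj G (o i) x = false) ->
  (forall i, i < 5 -> odd i != par -> block G (path_set f m) (o i) = Some (f 0)) ->
  exists sgn h, is_model G m par sgn h.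
Proof.
move=> pf [oX oinj otw _ ostd] obl om op; have [inj ad] := pf.
have indX := ind_path m9 pf; have X3 := card_path3 m9 pf.
have m0 : 0 < m by apply: leq_ltn_trans m9.
(* [k0] is the least index of the class of twins of [f 0]; its adjacency to [f 0] is the sign of the
   whole class. *)
pose k0 := if par then 0 else 1.
have k05 : k0 < 5 by rewrite /k0; case: (par).
have ok0 : odd k0 = ~~ par by rewrite /k0; case: (par).
exists (adj G (f 0) (o k0)), (fun i => if i < m then f i else o (i - m)).
have f0X : f 0 \in path_set f m by apply: mem_path_set.
have sgnE k : k < 5 -> odd k != par -> adj G (o k) (f 0) = adj G (f 0) (o k0).
  move=> k5 kp; rewrite [RHS]adj_sym; apply: otw => //; rewrite ok0.
  by move: kp; clear; case: (odd k); case: (par).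
have att k j : k < 5 -> j < m -> adj G (o k) (f j) = attached par (adj G (f 0) (o k0)) k j.
  move=> k5 jm; rewrite /attached; have [kp|kp] /= := boolP (odd k == par).
    by rewrite om // mem_path_set.
  have [->|j0] /= := eqVneq j 0; first exact: sgnE.
  rewrite orbF; have := blockP obl (oX k k5); rewrite op // => -[_ ->].
  - by rewrite ad // /consecutive /= eq_sym.
  - exact: mem_path_set.
  - by apply: contra j0 => /eqP/(inj _ _ jm m0)->.
have out k l : k < 5 -> l < 5 ->
    adj G (o k) (o l) = outer_adj par (adj G (f 0) (o k0)) k l.
  move=> k5 l5; rewrite /outer_adj; have [<-|kl] := eqVneq k l.
    by rewrite adj_irr eqxx.
  have exm i w : i < 5 -> odd i == par -> expected G (path_set f m) (o i) w = false.
    move=> i5 ip; rewrite /expected.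
    have -> : block G (path_set f m) (o i) = None.
      by apply: (block_uniq indX X3) => y z yX zX; rewrite !om.
    by apply/existsP => -[x /andP[xX]]; rewrite om.
  have exp i w : i < 5 -> odd i != par -> expected G (path_set f m) (o i) w = adj G (f 0) w.
    by move=> i5 ip; rewrite /expected op.
  have std_kl := ostd k l k5 l5 kl; have std_lk := ostd l k l5 k5; rewrite eq_sym in std_lk.
  have [kp|kp] := boolP (odd k == par); have [lp|lp] := boolP (odd l == par).
  - have E : odd k = odd l by rewrite (eqP kp) (eqP lp).
    move: std_kl; rewrite E eqxx consecutive_parity // /std exm //.
    by case: adj.
  - have E : odd k == odd l = false by rewrite (eqP kp) eq_sym (negPf lp).
    rewrite E adj_sym; move: std_lk => /(_ kl); rewrite /std exp //.
    have -> : adj G (f 0) (o k) = false by rewrite adj_sym om.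
    rewrite [consecutive l k]consecutive_sym.
    by case: (adj G _ _); case: (consecutive k l).
  - have E : odd k == odd l = false by rewrite (eqP lp) (negPf kp).
    rewrite E; move: std_kl; rewrite /std exp //.
    have -> : adj G (f 0) (o l) = false by rewrite adj_sym om.
    by case: (adj G _ _); case: (consecutive k l).
  - have E : odd k = odd l by move: kp lp; clear; case: (odd k); case: (odd l); case: (par).
    move: std_kl; rewrite E eqxx consecutive_parity // /std exp // => /eqP->.
    by rewrite adj_sym sgnE.
have im i : ~~ (i < m) -> i < m + 5 -> i - m < 5 /\ m <= i.
  by rewrite -leqNgt => mi im; rewrite ltn_subLR.
split=> // i j im5 jm5; [have [im'|im'] := boolP (i < m); have [jm'|jm'] := boolP (j < m)|].
- exact: inj.
- have [j5 _] := im _ jm' jm5; move=> E; have := oX _ j5; rewrite -E.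
  by rewrite mem_path_set.
- have [i5 _] := im _ im' im5; move=> E; have := oX _ i5; rewrite E.
  by rewrite mem_path_set.
- have [[i5 mi] [j5 mj]] := (im _ im' im5, im _ jm' jm5).
  by move=> /(oinj _ _ i5 j5) E; rewrite -(subnKC mi) E subnKC.
rewrite /model_adj; case: (ifPn (i < m)) => im'; case: (ifPn (j < m)) => jm'.
- exact: ad.
- by have [j5 _] := im _ jm' jm5; rewrite adj_sym att.
- by have [i5 _] := im _ im' im5; rewrite att.
- by have [[i5 mi] [j5 mj]] := (im _ im' im5, im _ jm' jm5); rewrite out.
Qed.

Lemma ends_full_model f : is_path G f m -> ends_full G m f ->
  exists par sgn h, is_model G m par sgn h.
Proof.
move=> pf full; have m0 : 0 < m by apply: leq_ltn_trans m9.
pose X := path_set f m.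
have indX := ind_path m9 pf; have X3 := card_path3 m9 pf.
have pX : f 0 \in path_set f m by apply: mem_path_set.
have qX : f m.-1 \in path_set f m by apply: mem_path_set; rewrite prednK.
have X5 := card_outside cardT pf.
have obl := outside_ex m9 cardT pf full.
have noext := no_extension indX X3 pX qX X5 full.
have [o op] := outside_path_ex indX X3 obl noext indV X5.
have [oX oinj otw obk ostd] := op.
have bE i j : i < 5 -> j < 5 -> odd i = odd j -> block G X (o i) = block G X (o j).
  by move=> i5 j5 ij; apply: (twins_block indX X3 obl) (oX i i5) (otw i j i5 j5 ij).
have ends i u : i < 5 -> block G X (o i) = Some u -> u = f 0 \/ u = f m.-1.
  move=> i5 bi; have [|uf0] := eqVneq u (f 0); first by left.
  have [|ufm] := eqVneq u (f m.-1); first by right.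
  have uX : u \in X by have := blockP obl (oX i i5); rewrite bi => -[].
  have neq j k : j < 5 -> k < 5 -> j != k -> o j != o k.
    by move=> j5 k5; apply: contra => /eqP/(oinj _ _ j5 k5)/eqP.
  have elim a b c d : a < 5 -> b < 5 -> c < 5 -> d < 5 -> odd a = odd i -> odd b = odd i ->
      odd c = ~~ odd i -> odd d = ~~ odd i -> uniq [:: a; b; c; d] ->
      [/\ consecutive c a, ~~ consecutive c b, consecutive d b & ~~ consecutive d a] -> False.
    move=> a5 b5 c5 d5 ai bi' ci di U [ca cb db da].
    have [nca ncb ndb nda] : [/\ c != a, c != b, d != b & d != a].
      move: U; rewrite /= !inE !negb_or -!andbA ![c == _]eq_sym ![d == _]eq_sym.
      by move=> /and5P[_ -> -> -> /and3P[-> _ _]].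
    apply: (inner_block indX X3 pX qX X5 full
      (u := u) (b1 := o a) (b2 := o b) (c1 := o c) (c2 := o d)) => //.
    - by rewrite !oX.
    - move: U; rewrite /= !inE !negb_or.
      by move=> /and4P[/and3P[? ? ?] /andP[? ?] ? _]; rewrite !neq.
    - by apply: otw; rewrite // ai bi'.
    - by apply: otw; rewrite // ci di.
    - by rewrite -bi; apply: bE.
    - rewrite -bi; apply: obk => //; by rewrite ci; case: odd.
    - by rewrite !ostd // ca cb db da.
  (* Two vertices of the class of [o i], and two of the other class each adjacent in P_5 to exactly
     one of them: 1, 3 against 0, 4, or 0, 4 against 1, 3. *)
  exfalso; case oi : (odd i) in elim.
    exact: (elim 1 3 0 4).
  exact: (elim 0 4 1 3).
have nstd i j : i < 5 -> j < 5 -> consecutive i j -> ~~ std G X (o i) (o j).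
  move=> i5 j5 ij; rewrite ostd // ?ij //.
  by apply: contraL ij => /eqP->; rewrite consecutive_parity.
have b01 : block G X (o 0) <> block G X (o 1) by apply: obk.
have pr := is_path_rev pf; have fullr := ends_full_rev full.
have Xr := path_set_rev f m.
have fr0 : (fun i => f (m - i.+1)) 0 = f m.-1 by rewrite /= subn1.
(* Within block [None], a neighbour in G_X whose block sits at an end of the path excludes X^+; for
   the last vertex the path is reversed. *)
have universal i j : i < 5 -> j < 5 -> consecutive i j ->
    block G X (o i) = None -> forall x, x \in X -> adj G (o i) x = false.
  move=> i5 j5 ij bi x xX; apply/negbTE/negP => cx.
  case bj : (block G X (o j)) => [u|]; last first.
    apply: (obk i j) => //; last by rewrite bi bj.
    by apply: contraL ij => /eqP E; rewrite consecutive_parity.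
  have nij := nstd i j i5 j5 ij.
  case: (ends j u j5 bj) => E; rewrite E in bj.
    exact: (universal_end m9 cardT pf full (oX j j5) (oX i i5) xX bj bi cx nij).
  have := @universal_end _ _ _ m9 cardT _ pr fullr (o j) (o i) x.
  by rewrite Xr fr0; apply; rewrite // ?oX.
(* The parity of the only class that can be X^-: the even one if [o 0] has block [None], otherwise
   the odd one. *)
pose par := if block G X (o 0) is Some _ then true else false.
have parE i : i < 5 -> block G X (o i) = block G X (o (odd i)).
  by move=> i5; apply: bE => //; case: odd.
have fin u : block G X (o par) = None -> block G X (o (~~ par)) = Some u ->
    exists par sgn h, is_model G m par sgn h.
  move=> bp bq.
  have om i : i < 5 -> odd i == par -> forall x, x \in X -> adj G (o i) x = false.
    move=> i5 /eqP ip; have bi : block G X (o i) = None by rewrite parE // ip.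
    have [j j5 ij] : exists2 j, j < 5 & consecutive i j.
      by move: i i5 {ip bi} => [|[|[|[|[|]]]]] // _;
        [exists 1 | exists 0 | exists 1 | exists 2 | exists 3].
    exact: (universal i j).
  have op' i : i < 5 -> odd i != par -> block G X (o i) = Some u.
    by move=> i5 ip; rewrite parE // -bq; move: ip; case: odd; case: (par).
  exists par; have p5 : ~~ par < 5 by case: (par).
  case: (ends (~~ par) u p5 bq) => E; rewrite E in op'.
    exact: (model_of_outside pf op obl om op').
  have := @model_of_outside _ o par pr; rewrite Xr fr0; exact.
rewrite /par in fin; case E0 : (block G X (o 0)) fin => [u|] fin; last first.
  by case E1 : (block G X (o 1)) => [u|]; [apply: (fin u) | case: b01; rewrite E0 E1].
case E1 : (block G X (o 1)) => [v|]; last exact: (fin u).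
have n01 : ~~ std G X (o 0) (o 1) by apply: nstd.
have n10 : ~~ std G X (o 1) (o 0) by apply: nstd.
(* Both classes now sit at ends of the path, and at different ends since their blocks differ. *)
exfalso; case: (ends 0 u isT E0) (ends 1 v isT E1) => E [] E'; rewrite E in E0; rewrite E' in E1.
- by case: b01; rewrite E0 E1.
- exact: (both_ends m9 cardT pf full (oX 0 isT) (oX 1 isT) E0 E1 n01).
- exact: (both_ends m9 cardT pf full (oX 1 isT) (oX 0 isT) E1 E0 n10).
- by case: b01; rewrite E0 E1.
Qed.
End ToModel.

(** * Indecomposability and covering for the explicit family *)

Lemma card_le1 (T : finType) (A : {set T}) : (forall x y, x \in A -> y \in A -> x = y) -> #|A| <= 1.
Proof. by move=> h; apply/card_le1_eqP => x y xA yA; apply: h. Qed.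

(** [A] and [W :\: A] are both intervals, and one of them has at least two elements. *)
Lemma disconnected_not_indec (T : finType) (G : graph T) (W A : {set T}) a b :
  2 < #|W| -> A \subset W -> a \in A -> b \in W -> b \notin A ->
  (forall x y, x \in A -> y \in W -> y \notin A -> adj G x y = false) -> ~~ indec G W.
Proof.
move=> W3 sAW aA bW bA h; apply/negP => /indecP indW.
have [//||A1|AW] := indW A; last by rewrite AW bW in bA.
  by move=> v x y vW vA xA yA; rewrite ![adj G v _]adj_sym !h.
have [||B1|BW] := indW (W :\: A); first exact: subsetDl.
- move=> v x y vW; rewrite inE vW andbT negbK => vA.
  by rewrite !inE => /andP[xA xW] /andP[yA yW]; rewrite !h.
- move: W3; rewrite ltnNge -(cardsID A W) (setIidPr sAW).
  by rewrite (leq_add (card_le1 A1) (card_le1 B1)).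
- by have := subsetP sAW a aA; rewrite -BW inE aA.
Qed.

Lemma twin_not_indec (T : finType) (G : graph T) (W : {set T}) u v :
  2 < #|W| -> u \in W -> v \in W -> u != v ->
  (forall w, w \in W -> w != u -> w != v -> adj G w u = adj G w v) -> ~~ indec G W.
Proof.
move=> W3 uW vW uv h; apply/negP => /indecP indW.
have [||I1|IW] := indW [set u; v]; first by rewrite subUset !sub1set uW.
- move=> w x y wW; rewrite !inE negb_or => /andP[wu wv].
  by move=> /orP[]/eqP-> /orP[]/eqP->; rewrite ?h.
- by case/eqP: uv; apply: I1; rewrite !inE eqxx ?orbT.
- by move: W3; rewrite -IW cards2; case: (u != v).
Qed.

Section FromModel.
Variables (T : finType) (G : graph T) (m : nat) (par sgn : bool) (h : nat -> T).
Hypotheses (m9 : 8 < m) (mod : is_model G m par sgn h).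
Local Notation adj := (adj G).
Local Notation indec := (indec G).
Local Notation X := (path_set h m).
Local Notation o k := (h (m + k)).

Let cardT : #|T| = m + 5. Proof. by case: mod. Qed.
Let m0 : 0 < m. Proof. exact: leq_ltn_trans m9. Qed.
Let m1 : 1 < m. Proof. exact: leq_ltn_trans m9. Qed.

Lemma model_inj i j : i < m + 5 -> j < m + 5 -> h i = h j -> i = j.
Proof. by case: mod => _ inj _; apply: inj. Qed.

Lemma model_vertex x : exists2 i, i < m + 5 & x = h i.
Proof.
have inj : injective (fun i : 'I_(m + 5) => h i).
  by move=> i j /model_inj E; apply: val_inj; apply: E.
have : x \in codom (fun i : 'I_(m + 5) => h i).
  by rewrite inj_card_onto // cardT card_ord.
by case/codomP=> i ->; exists i.
Qed.

Lemma model_vertexP x : (exists2 i, i < m & x = h i) \/ (exists2 k, k < 5 & x = o k).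
Proof.
have [i im ->] := model_vertex x; case: (ltnP i m) => mi; first by left; exists i.
by right; exists (i - m); rewrite ?subnKC // ltn_subLR.
Qed.

Lemma model_path_adj i j : i < m -> j < m -> adj (h i) (h j) = consecutive i j.
Proof.
move=> im jm; case: mod => _ _ ->; rewrite ?(leq_trans im) ?(leq_trans jm) ?leq_addr //.
by rewrite /model_adj im jm.
Qed.

Lemma model_attached k j : k < 5 -> j < m -> adj (o k) (h j) = attached par sgn k j.
Proof.
move=> k5 jm; case: mod => _ _ ->; rewrite ?ltn_add2l ?(leq_trans jm) ?leq_addr //.
by rewrite /model_adj ltnNge leq_addr jm /= addKn.
Qed.

Lemma model_outer k l : k < 5 -> l < 5 -> adj (o k) (o l) = outer_adj par sgn k l.
Proof.
move=> k5 l5; case: mod => _ _ ->; rewrite ?ltn_add2l //.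
by rewrite /model_adj !ltnNge !leq_addr /= !addKn.
Qed.

Lemma model_path : is_path G h m.
Proof.
split; last exact: model_path_adj.
by move=> i j im jm; apply: model_inj; apply: ltn_addr.
Qed.

Lemma model_outer_inj k l : k < 5 -> l < 5 -> o k = o l -> k = l.
Proof.
by move=> k5 l5 /model_inj E; apply/eqP; rewrite -(eqn_add2l m) E // ltn_add2l.
Qed.

Lemma model_notin k : k < 5 -> o k \notin X.
Proof.
move=> k5; apply/path_setP => -[i im E].
have := model_inj _ _ E; rewrite ltn_add2l => /(_ k5 (ltn_addr _ im)).
by move=> Ei; move: im; rewrite -Ei ltnNge leq_addr.
Qed.

Lemma model_outsideP x : reflect (exists2 k, k < 5 & x = o k) (x \notin X).
Proof.
apply: (iffP idP) => [xX|[k k5 ->]]; last exact: model_notin.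
by have [[i im E]|//] := model_vertexP x; rewrite E mem_path_set in xX.
Qed.

Definition model_block k := if odd k == par then None else Some (h 0).

Lemma model_minus_adj k i : k < 5 -> odd k == par -> i < m -> adj (o k) (h i) = false.
Proof. by move=> k5 kp im; rewrite model_attached // /attached kp. Qed.

Lemma model_in_block k : k < 5 -> in_block G X (model_block k) (o k).
Proof.
move=> k5; rewrite /model_block; case: ifPn => kp.
  by move=> y z /path_setP[i im ->] /path_setP[j jm ->]; rewrite !model_minus_adj.
split=> [|_ /path_setP[i im ->] i0]; first exact: mem_path_set.
have i0' : i != 0 by apply: contraNneq i0 => ->.
by rewrite model_attached // model_path_adj // /attached kp (negPf i0') /consecutive /= orbF.
Qed.

Let indX : indec X. Proof. by apply: indec_path model_path; apply: leq_trans m9. Qed.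
Let X3 : 2 < #|X|. Proof. by rewrite (card_path_set model_path); apply: leq_trans m9. Qed.

Lemma model_block_uniq b k : k < 5 -> in_block G X b (o k) -> b = model_block k.
Proof. by move=> k5 hb; apply: in_block_uniq indX X3 hb (model_in_block k5). Qed.

Lemma outside_edge_minus k l (Z : {set T}) : k < 5 -> l < 5 -> odd k == par -> odd l != par ->
  indec Z -> 2 < #|Z| -> h 0 \in Z -> o k \notin Z -> o l \notin Z ->
  in_block G Z None (o k) -> in_block G Z (Some (h 0)) (o l) -> consecutive k l ->
  indec (o k |: (o l |: Z)).
Proof.
move=> k5 l5 kp lp indZ Z3 h0 kZ lZ hk hl kl; apply: indecU2 hk hl _ => //.
  apply: contraTneq kl => /(model_outer_inj k5 l5)->; by rewrite consecutive_parity.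
move=> /(_ (o l) (h 0)); rewrite setU11 setU1r // => /(_ isT isT).
rewrite model_outer // [adj _ (h 0)]model_minus_adj // /outer_adj (eqP kp) eq_sym (negPf lp).
by rewrite kl.
Qed.

(** [Z] may already contain other outside vertices, as long as [o k] and [o l] have kept their
    blocks. *)
Lemma outside_edge k l (Z : {set T}) : k < 5 -> l < 5 -> consecutive k l ->
  indec Z -> 2 < #|Z| -> h 0 \in Z -> o k \notin Z -> o l \notin Z ->
  in_block G Z (model_block k) (o k) -> in_block G Z (model_block l) (o l) ->
  indec (o k |: (o l |: Z)).
Proof.
move=> k5 l5 kl indZ Z3 h0 kZ lZ.
have par_kl : odd k != odd l by apply: contraL kl => /eqP E; rewrite consecutive_parity.
rewrite /model_block; case: ifPn => kp; case: ifPn => lp hk hl.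
- by rewrite (eqP kp) (eqP lp) eqxx in par_kl.
- exact: outside_edge_minus.
- by rewrite setUCA; apply: outside_edge_minus => //; rewrite consecutive_sym.
- by move: par_kl kp lp; case: (odd k); case: (odd l); case: (par).
Qed.

Lemma model_in_blockU k l (Z : {set T}) : k < 5 -> l < 5 -> k != l -> ~~ consecutive k l ->
  h 0 \in Z -> in_block G Z (model_block k) (o k) ->
  in_block G (o l |: Z) (model_block k) (o k).
Proof.
move=> k5 l5 kl nkl h0; rewrite /model_block; case: ifPn => kp hk.
  have K z : z \in o l |: Z -> adj (o k) z = adj (o k) (h 0).
    rewrite in_setU1 => /orP[/eqP->|zZ]; last exact: hk.
    by rewrite [adj _ (h 0)]model_minus_adj // model_outer // /outer_adj (negPf nkl) kp kl if_same.
  by move=> y z /K-> /K->.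
case: hk => _ hk; split=> [|z]; first exact: setU1r.
rewrite in_setU1 => /orP[/eqP-> _|zZ]; last exact: hk.
rewrite model_outer // adj_sym model_attached // /outer_adj /attached eqxx /= kl (negPf nkl) kp.
by case: eqVneq => [<-|]; [rewrite kp | move: kp; case: (odd k); case: (odd l); case: (par)].
Qed.

(** The edges 0 1 and 3 4 of P_5 have no edge between them, so they can be added to X one after the
    other. Then the middle vertex fits no block: its block over X is spoiled by its neighbour 1,
    twins of 0 and 4 are excluded by 3 and 1, and twins of 1 and 3 by [h 1]. *)
Lemma model_indec : indec setT.
Proof.
have oN k l : k < 5 -> l < 5 -> k != l -> o k != o l.
  by move=> k5 l5; apply: contra => /eqP/model_outer_inj->.
have h0o k : k < 5 -> h 0 != o k.
  by move=> k5; apply: contraNneq (model_notin k5) => <-; apply: mem_path_set.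
have h0X : h 0 \in X by apply: mem_path_set.
have ind1 : indec (o 0 |: (o 1 |: X)).
  by apply: outside_edge; rewrite ?model_notin //; apply: model_in_block.
have nin1 k : k < 5 -> 1 < k -> o k \notin o 0 |: (o 1 |: X).
  by case: k => [|[|[|[|[|]]]]] // _ _; rewrite !in_setU1 !negb_or model_notin // !oN.
have c1 : 2 < #|o 0 |: (o 1 |: X)|.
  by apply: leq_trans X3 _; apply: subset_leq_card; rewrite setUA subsetUr.
have bl1 k : k < 5 -> 2 < k -> in_block G (o 0 |: (o 1 |: X)) (model_block k) (o k).
  by case: k => [|[|[|[|[|]]]]] // _ _; do 2!(apply: model_in_blockU; rewrite ?setU1r //);
    apply: model_in_block.
have ind2 : indec (o 3 |: (o 4 |: (o 0 |: (o 1 |: X)))).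
  apply: outside_edge; rewrite ?nin1 // ?setU1r // ?setU1r //; exact: bl1.
have -> : setT = o 2 |: (o 3 |: (o 4 |: (o 0 |: (o 1 |: X)))).
  symmetry; apply/setP => x; rewrite [RHS]in_setT !in_setU1.
  have [[i im ->]|[k k5 ->]] := model_vertexP x; first by rewrite mem_path_set ?orbT.
  by case: k k5 => [|[|[|[|[]]]]] //; rewrite eqxx ?orbT.
have n2 : o 2 \notin o 3 |: (o 4 |: (o 0 |: (o 1 |: X))).
  by rewrite 2!in_setU1 !negb_or nin1 // !oN.
have [//|[d hd]] := indecU1 ind2 n2; exfalso.
set W := o 3 |: _ in hd.
have sXW : X \subset W by apply/subsetP => x xX; do 4!apply: setU1r.
have memo k : k < 5 -> k != 2 -> o k \in W.
  by case: k => [|[|[|[|[|]]]]] // _ _; rewrite !in_setU1 eqxx ?orbT.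
have a2 k : k < 5 -> adj (o 2) (o k) = outer_adj par sgn 2 k by move=> k5; rewrite model_outer.
have dX : d = model_block 2 -> False.
  move=> E; rewrite E /model_block in hd; move: hd; case: ifP => p2 hd.
    have := hd (o 1) (h 0) (memo 1 isT isT) (subsetP sXW _ h0X).
    by rewrite [adj _ (h 0)]model_minus_adj // a2.
  case: hd => _ /(_ (o 1) (memo 1 isT isT)); rewrite eq_sym h0o // => /(_ isT).
  rewrite a2 // adj_sym model_attached //.
  by move: p2; rewrite /attached /outer_adj /=; case: (par).
case: d hd dX => [w [wW hw]|hd] dX; last first.
  by apply: dX; apply: model_block_uniq => //; apply: in_blockS sXW hd _.
have [[i im E]|[k k5 E]] := model_vertexP w.
  apply: dX; apply: model_block_uniq => //; apply: (@in_blockS _ _ _ W) => //.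
  by move=> u [<-]; rewrite E mem_path_set.
have k2 : k != 2 by apply: contraNneq n2 => k2; rewrite k2 in E; rewrite -E.
have [k04|k13] : k \in [:: 0; 4] \/ k \in [:: 1; 3].
  by case: k k5 k2 {E} => [|[|[|[|[|]]]]] //; auto.
- move: k04; rewrite !inE => /orP[]/eqP k_; subst w k.
    by have := hw (o 3) (memo 3 isT isT); rewrite !model_outer // oN // => /(_ isT).
  by have := hw (o 1) (memo 1 isT isT); rewrite !model_outer // oN // => /(_ isT).
- have hW : h 1 \in W by apply: (subsetP sXW); apply: mem_path_set.
  have := hw _ hW; rewrite E => /(_ _).
  rewrite !model_attached // => H; have := H _; rewrite /attached.
  have -> : odd k by move: k13; rewrite !inE => /orP[]/eqP->.
  have : h 1 != o k by apply: contraNneq (model_notin k5) => <-; apply: mem_path_set.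
  by move=> /[swap]/[apply]; case: (par).
Qed.

(** [A] is what remains of the path beyond [i]. Outside vertices are attached at most to positions 0
    and 1, and [i] is at least 1, so [A] is cut off; the conditions on [y] keep a vertex on each
    side. *)
Lemma model_pair_path i y : 0 < i -> i < m.-1 -> y != h i -> y != h 0 -> y != h m.-1 ->
  ~~ indec (~: [set h i; y]).
Proof.
move=> i0 im yi y0 ym; have mP : m.-1 < m by rewrite prednK.
have im' : i < m by apply: leq_trans mP; apply: ltnW.
pose A := [set x in ~: [set h i; y] | [exists k : 'I_m, (i < k) && (x == h k)]].
have AP x : x \in A -> exists k, [/\ k < m, i < k & x = h k].
  by rewrite inE => /andP[_ /existsP[k /andP[ik /eqP->]]]; exists k.
have neq j k : j < m + 5 -> k < m + 5 -> j != k -> h j != h k.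
  by move=> jm km; apply: contra => /eqP/(model_inj jm km)->.
have lt5 k : k < m -> k < m + 5 by apply: ltn_addr.
apply: (@disconnected_not_indec _ _ _ A (h m.-1) (h 0)).
- by have := cardsC [set h i; y]; rewrite cards2 cardT; move: m9; clear; case: (_ != _); lia.
- by apply/subsetP => x; rewrite inE => /andP[].
- rewrite !inE negb_or eq_sym neq ?lt5 // ?[h _ == y]eq_sym ?ym; last by rewrite ltn_eqF.
  by apply/existsP; exists (Ordinal mP); rewrite /= im eqxx.
- by rewrite !inE negb_or [_ == y]eq_sym y0 neq ?lt5 // eq_sym -lt0n.
- rewrite inE negb_and orbC; apply/orP; left; apply/existsP => -[k /andP[ik /eqP]].
  by move/(model_inj (lt5 _ m0) (lt5 _ (ltn_ord k))) => E; rewrite -E in ik.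
- move=> x z /AP[k [km ik ->]] zW zA.
  have nex : ~~ [exists k : 'I_m, (i < k) && (z == h k)].
    by apply: contra zA => e; rewrite in_set zW e.
  have zi : z != h i by move: zW; rewrite !inE negb_or => /andP[].
  have [[j jm E]|[l l5 E]] := model_vertexP z; rewrite E in zi nex *.
    rewrite model_path_adj //.
    have ji : j <= i.
      rewrite leqNgt; apply/negP => ij; move/negP: nex; apply.
      by apply/existsP; exists (Ordinal jm); rewrite /= ij eqxx.
    have nji : j != i by apply: contra zi => /eqP->.
    rewrite /consecutive; move: ik ji nji; clear; lia.
  rewrite adj_sym model_attached // /attached.
  have -> : (k == 1) = false by rewrite gtn_eqF //; apply: leq_trans ik.
  have -> : (k == 0) = false by rewrite gtn_eqF //; apply: leq_trans ik.
  by rewrite andbF.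
Qed.

(** This and [twins_in] describe P_5 with [a] and [b] removed; all pairs are settled by computation
    in [path5_pairs]. *)
Definition isolated_in a b k :=
  [&& k != a, k != b & all (fun l => [|| l == a, l == b | ~~ consecutive k l]) (iota 0 5)].
Definition twins_in a b k l :=
  [&& k != a, k != b, l != a, l != b, k != l, odd k == odd l &
      all (fun c => [|| c == a, c == b | consecutive k c == consecutive l c]) (iota 0 5)].

Lemma path5_pairs a b : a < 5 -> b < 5 -> a != b ->
  (exists2 k, k < 5 & isolated_in a b k) \/
  (exists k l, [/\ k < 5, l < 5 & twins_in a b k l]).
Proof.
move=> a5 b5 /negPf ab.
have : all (fun a => all (fun b => (a == b) || has (isolated_in a b) (iota 0 5) ||
   has (fun k => has (twins_in a b k) (iota 0 5)) (iota 0 5)) (iota 0 5)) (iota 0 5) by [].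
move/allP/(_ a); rewrite mem_iota => /(_ a5)/allP/(_ b); rewrite mem_iota => /(_ b5).
rewrite ab => /orP[/hasP[k]|/hasP[k + /hasP[l]]]; rewrite !mem_iota => k5.
  by left; exists k.
by move=> l5 tw; right; exists k, l; split=> //; rewrite mem_iota in l5.
Qed.

Lemma model_pair_outer a b : a < 5 -> b < 5 -> a != b -> ~~ indec (~: [set o a; o b]).
Proof.
move=> a5 b5 ab.
have neq k l : k < 5 -> l < 5 -> k != l -> o k != o l.
  by move=> k5 l5; apply: contra => /eqP/(model_outer_inj k5 l5)->.
have neqh i k : i < m -> k < 5 -> h i != o k.
  by move=> im k5; apply: contraNneq (model_notin k5) => <-; apply: mem_path_set.
have W3 : 2 < #|~: [set o a; o b]|.
  by have := cardsC [set o a; o b]; rewrite cards2 neq // cardT; move: m9; clear; lia.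
have inW k : k < 5 -> k != a -> k != b -> o k \in ~: [set o a; o b].
  by move=> k5 ka kb; rewrite !inE negb_or !neq.
have inWh i : i < m -> h i \in ~: [set o a; o b] by move=> im; rewrite !inE negb_or !neqh.
have WP x : x \in ~: [set o a; o b] -> (exists2 i, i < m & x = h i) \/
    (exists l, [/\ l < 5, l != a, l != b & x = o l]).
  have [|[l l5 ->]] := model_vertexP x; [by left | move=> lW; right; exists l].
  move: lW; rewrite !inE negb_or => /andP[la lb].
  by split=> //; [apply: contraNneq la | apply: contraNneq lb] => ->.
have [[k k5 /and3P[ka kb /allP iso]]|[k [l [k5 l5]]]] := path5_pairs a5 b5 ab.
  have isoP l : l < 5 -> l != a -> l != b -> consecutive k l = false.
    by move=> l5 la lb; have := iso l; rewrite mem_iota (negPf la) (negPf lb) => /(_ l5)/negbTE.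
  have [kp|kp] := boolP (odd k == par).
    apply: (@disconnected_not_indec _ _ _ [set o k] (o k) (h 0)) => //.
    - by rewrite sub1set inW.
    - by rewrite inE.
    - exact: inWh.
    - by rewrite inE neqh.
    - move=> x y; rewrite !in_set1 => /eqP-> /WP[[i im ->] _|[l [l5 la lb ->]] lk].
        by rewrite model_minus_adj.
      rewrite model_outer // /outer_adj isoP // kp /= andbF; by case: ifP.
  (* With no neighbour left in X^-, the vertex [o k] cannot be told from [h 0]: both see [h 1] on
     the path, and both see the rest of its class according to [sgn]. *)
  apply: (@twin_not_indec _ _ _ (h 0) (o k)) => //; [exact: inWh | exact: inW | exact: neqh |].
  move=> w /WP[[i im ->]|[l [l5 la lb ->]]] w0 wk.
    rewrite model_path_adj // adj_sym model_attached // /attached kp /consecutive /=.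
    have i0 : i != 0 by apply: contraNneq w0 => ->.
    by rewrite (negPf i0) orbF.
  rewrite model_attached // model_outer // /attached /outer_adj consecutive_sym isoP //=.
  have lk : l != k by apply: contraNneq wk => ->.
  rewrite lk /=; move: kp; clear; by case: (odd l); case: (odd k); case: (par).
case/and5P=> ka kb la lb /and3P[kl /eqP okl /allP tw].
apply: (@twin_not_indec _ _ _ (o k) (o l)) => //; [exact: inW | exact: inW | exact: neq |].
move=> w /WP[[i im ->]|[c [c5 ca cb ->]]] wk wl.
  by rewrite ![adj (h i) _]adj_sym !model_attached // /attached okl.
have ck : c != k by apply: contraNneq wk => ->.
have cl : c != l by apply: contraNneq wl => ->.
rewrite !model_outer // /outer_adj okl ck cl ![consecutive c _]consecutive_sym.
have := tw c; rewrite mem_iota (negPf ca) (negPf cb) => /(_ c5)/eqP /= ->.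
by [].
Qed.

Lemma model_pair x y : x != y -> x != h 0 -> x != h m.-1 -> y != h 0 -> y != h m.-1 ->
  ~~ indec (~: [set x; y]).
Proof.
move=> xy x0 xm y0 ym.
have inner i : i < m -> h i != h 0 -> h i != h m.-1 -> 0 < i /\ i < m.-1.
  move=> im i0 im'; split; first by rewrite lt0n; apply: contraNneq i0 => ->.
  by rewrite ltn_neqAle -ltnS prednK // im andbT; apply: contraNneq im' => ->.
have [[i im E]|[a a5 E]] := model_vertexP x; rewrite E in xy x0 xm *.
  by have [i0 im'] := inner i im x0 xm; apply: model_pair_path; rewrite // eq_sym.
have [[j jm E']|[b b5 E']] := model_vertexP y; rewrite E' in xy y0 ym *.
  by have [j0 jm'] := inner j jm y0 ym; rewrite setUC; apply: model_pair_path.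
by apply: model_pair_outer => //; apply: contraNneq xy => ->.
Qed.
End FromModel.

(** * Comparison with both descriptions *)

Lemma isomorphic_trans (T U V : finType) (G : graph T) (H : graph U) (K : graph V) :
  isomorphic G H -> isomorphic H K -> isomorphic G K.
Proof.
move=> [f [bf fE]] [g [bg gE]]; exists (g \o f); split; first exact: bij_comp.
by move=> x y /=; rewrite gE fE.
Qed.

Section ModelGraph.
Variables (m : nat) (par sgn : bool).

Definition model_rel : rel 'I_(m + 5) := fun i j => model_adj m par sgn i j.

Lemma model_rel_sym : symmetric model_rel.
Proof.
move=> i j; rewrite /model_rel /model_adj; case: (i < m); case: (j < m) => //.
  exact: consecutive_sym.
rewrite /outer_adj [odd (j - m) == _]eq_sym; case: eqP => [->|_]; last exact: consecutive_sym.
by rewrite eq_sym.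
Qed.

Lemma model_rel_irr : irreflexive model_rel.
Proof.
move=> i; rewrite /model_rel /model_adj /outer_adj !eqxx /= consecutive_parity //.
by case: (i < m).
Qed.

Definition model_graph : graph 'I_(m + 5) := Graph model_rel_sym model_rel_irr.
End ModelGraph.

Lemma is_model_iso (T : finType) (G : graph T) m par sgn h :
  is_model G m par sgn h -> isomorphic G (model_graph m par sgn).
Proof.
move=> [cardT inj ad].
have injF : injective (fun i : 'I_(m + 5) => h i) by move=> i j /inj E; apply/val_inj/E.
have [F FK KF] := inj_card_bij injF (eq_leq (etrans cardT (esym (card_ord _)))).
exists F; split; first by exists (fun i : 'I_(m + 5) => h i).
by move=> x y; rewrite -{2}[x]KF -{2}[y]KF ad.
Qed.

Lemma XtwinP (T : finType) (G : graph T) (X : {set T}) u v : u \in X ->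
  reflect (v \notin X /\ in_block G X (Some u) v) (v \in Xtwin G X u).
Proof.
move=> uX; rewrite !inE; apply: (iffP andP) => -[vX h]; split=> //.
  split=> // z zX zu; have zW : z \in v |: X by rewrite setU1r.
  have uW : u \in v |: X by rewrite setU1r.
  have vW : v \in v |: X by rewrite setU11.
  have zv : z != v by apply: contraNneq vX => <-.
  pose sub w (wW : w \in v |: X) : {w | w \in v |: X} := exist (fun w => w \in v |: X) w wW.
  have /forall_inP/(_ (sub z zW)) := h; rewrite !inE /= negb_or zu zv => /(_ isT).
  case/orP => /forall_inP t; have := t (sub u uW); have := t (sub v vW);
    rewrite !inE /= !eqxx orbT => /(_ isT) + /(_ isT); rewrite /induced_rel /= ![adj G z _]adj_sym.
    by move=> -> ->.
  by move=> /negbTE-> /negbTE->.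
case: h => _ h; apply/forall_inP => -[z zW]; rewrite !inE /= negb_or => /andP[zu zv].
have zX : z \in X by move: zW; rewrite in_setU1 (negPf zv).
have E : adj G z v = adj G z u by rewrite adj_sym h // adj_sym.
case zuE : (adj G z u); apply/orP; [left | right]; apply/forall_inP => -[x xW];
  by rewrite !inE /= /induced_rel /= => /orP[]/eqP->; rewrite ?E zuE.
Qed.

Lemma XminusP (T : finType) (G : graph T) (X : {set T}) v :
  reflect (v \notin X /\ forall x, x \in X -> adj G v x = false) (v \in Xminus G X).
Proof.
rewrite !inE; apply: (iffP andP) => -[vX h]; split=> //.
  by move=> x xX; apply/negbTE; apply: (forall_inP h).
by apply/forall_inP => x xX; rewrite h.
Qed.

Lemma empty_inducedP (T : finType) (G : graph T) (Y : {set T}) :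
  reflect (forall x y, x \in Y -> y \in Y -> adj G x y = false) (empty_graph (induced G Y)).
Proof.
apply: (iffP forallP) => [h x y xY yY|h [x xY]].
  apply/negbTE; have /forallP/(_ (exist (fun y => y \in Y) y yY)) := h (exist (fun y => y \in Y) x xY).
  by [].
by apply/forallP => -[y yY]; rewrite /= /induced_rel /= h.
Qed.

Lemma complete_inducedP (T : finType) (G : graph T) (Y : {set T}) :
  reflect (forall x y, x \in Y -> y \in Y -> x != y -> adj G x y)
          (complete_graph (induced G Y)).
Proof.
apply: (iffP forallP) => [h x y xY yY xy|h [x xY]].
  have /forallP/(_ (exist (fun y => y \in Y) y yY)) := h (exist (fun y => y \in Y) x xY).
  by rewrite -(inj_eq val_inj) /= xy.
apply/forallP => -[y yY]; apply/implyP; rewrite -(inj_eq val_inj) /= => xy.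
exact: h.
Qed.

Lemma model_outside_edge (T : finType) (G : graph T) m par sgn h k l :
  8 < m -> is_model G m par sgn h -> k < 5 -> l < 5 -> k != l ->
  indec G (path_set h m :|: [set h (m + k); h (m + l)]) = consecutive k l.
Proof.
move=> m9 mod k5 l5 kl; have pf := model_path mod; set X := path_set h m.
have indX : indec G X by apply: indec_path pf; apply: leq_trans m9.
have X3 : 2 < #|X| by rewrite (card_path_set pf); apply: leq_trans m9.
have h0 : h 0 \in X by apply: mem_path_set; apply: leq_ltn_trans m9.
have [kX lX] := (model_notin mod k5, model_notin mod l5).
have [hk hl] := (model_in_block m9 mod k5, model_in_block m9 mod l5).
have okl : h (m + k) != h (m + l).
  by apply: contra kl => /eqP/(model_outer_inj mod k5 l5)->.
rewrite setUC -setUA; have [ckl|nkl] := boolP (consecutive k l).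
  exact: (outside_edge m9 mod).
apply/negbTE; apply: (@in_block_not_indecU2 _ _ _ (model_block par h k)) => //.
- exact: ltnW.
- exact: (model_in_blockU m9 mod).
- by rewrite /model_block; case: ifP => // _ [E]; rewrite -E h0 in lX.
Qed.

(** * Graphs on {1, ..., n} with their canonical numbering *)

Section Canonical.
Variables (n m : nat).
Hypotheses (nm : n = m + 5) (m9 : 8 < m).

Let n_gt0 : 0 < n. Proof. by rewrite nm addnS. Qed.

(** Numbers not below [n] are sent to the first vertex. *)
Definition vertex : nat -> 'I_n := insubd (Ordinal n_gt0).

Lemma val_vertex i : i < n -> vertex i = i :> nat.
Proof. by move=> i_n; rewrite val_insubd i_n. Qed.

Lemma vertexK (i : 'I_n) : vertex i = i.
Proof. exact: valKd. Qed.

Let mn : m <= n. Proof. by rewrite nm leq_addr. Qed.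

Lemma mem_vertex_path i : (i \in path_set vertex m) = (i < m).
Proof.
apply/path_setP/idP => [[k km ->]|im]; first by rewrite val_vertex // (leq_trans km).
by exists i; rewrite ?vertexK.
Qed.

Lemma vertex_inj i j : i < n -> j < n -> vertex i = vertex j -> i = j.
Proof. by move=> /val_vertex {2}<- /val_vertex {2}<- ->. Qed.

Lemma labelled_iota : labelled n (iota 1 m) = path_set vertex m.
Proof. by apply/setP => i; rewrite inE mem_vertex_path mem_iota /label add1n ltnS. Qed.

Lemma labelled_last5 :
  ~: labelled n [:: n; n - 1; n - 2; n - 3; n - 4] = path_set vertex m.
Proof.
apply/setP => i; rewrite !inE mem_vertex_path /label; have := ltn_ord i.
by move: (nat_of_ord i) nm m9; clear; lia.
Qed.

Lemma labelled_ends : labelled n [:: 1; m] = [set vertex 0; vertex m.-1].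
Proof.
have m0 : 0 < m by apply: leq_ltn_trans m9.
apply/setP => i; rewrite !inE /label -!(inj_eq (@ord_inj n)) !val_vertex.
- by rewrite eqSS -(prednK m0) eqSS.
- by apply: leq_trans mn; rewrite prednK.
- by apply: leq_trans mn.
Qed.

Variable G : graph 'I_n.

Lemma induces_pathP :
  induces_path G (path_set vertex m) m <-> is_path G vertex m.
Proof.
split=> [[_ E]|[_ ad]]; first split.
- by move=> i j im jm; apply: vertex_inj; [apply: leq_trans mn | apply: leq_trans mn].
- move=> i j im jm; have [iX jX] := (mem_path_set vertex im, mem_path_set vertex jm).
  have := E (exist (fun x => x \in path_set vertex m) _ iX)
            (exist (fun x => x \in path_set vertex m) _ jX) (Ordinal im) (Ordinal jm).
  by rewrite /label /= !val_vertex ?(leq_trans _ mn) // => /(_ erefl erefl).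
split=> [k|[x xX] [y yX] u v]; last first.
  rewrite /label /= => -[xu] [yv]; rewrite /induced_rel /= /path_rel /label !eqSS.
  by rewrite -[x]vertexK -[y]vertexK xu yv ad.
apply/codomP/codomP => [[[x xX] ->]|[i ->]].
  have xm : x < m by rewrite -mem_vertex_path.
  by exists (Ordinal xm).
have im : vertex i \in path_set vertex m by apply: mem_path_set.
by exists (exist (fun x => x \in path_set vertex m) _ im); rewrite /label /= val_vertex // (leq_trans _ mn).
Qed.

Lemma indec_delete x y : indecomposable (delete G [set x; y]) = indec G (~: [set x; y]).
Proof. by []. Qed.

Lemma Pminus5_model : Pminus5 G -> exists par sgn h, is_model G m par sgn h.
Proof.
have nm5 : n - 5 = m by rewrite nm addnK.
rewrite /Pminus5 labelled_last5 nm5 labelled_ends => -[_ indG cov /induces_pathP pf].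
have cardn : #|'I_n| = m + 5 by rewrite card_ord.
apply: (ends_full_model m9 cardn _ pf); first by rewrite -indecT.
move=> Z Z0 Zm Z3 indZ evZ; case Ek : #|~: Z| => [|k].
  by rewrite -[Z]setCK (cards0_eq Ek) setC0.
(* [k] is the predecessor of an even positive number, hence odd. The pair then removed lies outside
   [Z], so it avoids both ends and contradicts [cov]. *)
have cardZ : #|setT :\: Z| = k./2.*2.+2.
  have ok : odd k by move: evZ; rewrite Ek /= negbK.
  by rewrite setTD Ek -{1}(odd_double_half k) ok.
rewrite indecT in indG.
have [x [y [xZ yZ xy ind]]] := indec_remove_pair indZ Z3 indG (subsetT Z) cardZ.
have := forallP (forallP cov x) y; rewrite /= /indec_rel xy indec_delete -setTD ind !inE /=.
move: xZ yZ; rewrite !inE !andbT => xZ yZ.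
by case/orP => /orP[]/eqP E; [move: xZ | move: xZ | move: yZ | move: yZ]; rewrite E ?Z0 ?Zm.
Qed.

Lemma model_Pminus5 par sgn : is_model G m par sgn vertex -> Pminus5 G.
Proof.
move=> mod; have nm5 : n - 5 = m by rewrite nm addnK.
split.
- by move: nm m9; clear; lia.
- by rewrite indecT; apply: model_indec mod.
- rewrite nm5 labelled_ends; apply/forallP => x; apply/forallP => y; apply/implyP.
  case/andP=> xy; rewrite indec_delete !inE; apply: contraTT.
  rewrite !negb_or => /andP[/andP[x0 xm] /andP[y0 ym]].
  exact: (model_pair m9 mod).
- by rewrite labelled_last5 nm5; apply/induces_pathP; apply: model_path mod.
Qed.


Local Notation X := (path_set vertex m).
Local Notation o k := (vertex (m + k)).

Lemma model_special par sgn : is_model G m par sgn vertex -> special_form G.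
Proof.
move=> mod; have nm5 : n - 5 = m by rewrite nm addnK.
have pf := model_path mod.
have m0 : 0 < m by apply: leq_ltn_trans m9.
have h0X : vertex 0 \in X by apply: mem_path_set.
have oX k : k < 5 -> o k \notin X by apply: (model_notin mod).
have out x : x \notin X -> exists2 k, k < 5 & x = o k by move/(model_outsideP mod).
have oinj := model_outer_inj mod.
have buniq b k := @model_block_uniq _ _ _ _ _ _ m9 mod b k.
have minusP k : k < 5 -> (o k \in Xminus G X) = (odd k == par).
  move=> k5; apply/XminusP/idP => [[_ h]|kp]; last first.
    by split=> [|_ /path_setP[i im ->]]; rewrite ?oX // (model_minus_adj mod).
  have : None = model_block par vertex k.
    by apply: buniq => // y z yX zX; rewrite !h.
  by rewrite /model_block; case: ifP.
have twinP u k : k < 5 -> u \in X -> (o k \in Xtwin G X u) = (u == vertex 0) && (odd k != par).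
  move=> k5 uX; apply/(XtwinP _ _ uX)/andP => [[_ /(buniq _ _ k5)]|[/eqP-> kp]].
    by rewrite /model_block; case: ifP => // _ [->].
  split; first exact: oX.
  by have := model_in_block m9 mod k5; rewrite /model_block (negPf kp).
have twin0 k : k < 5 -> odd k != par -> adj G (vertex 0) (o k) = sgn.
  by move=> k5 kp; rewrite adj_sym (model_attached mod) // /attached kp.
have class_adj k l : k < 5 -> l < 5 -> odd k != par -> odd l != par ->
    adj G (o k) (o l) = (k != l) && sgn.
  move=> k5 l5 kp lp; rewrite (model_outer mod) // /outer_adj.
  have -> : odd k = odd l by move: kp lp; clear; case: (odd k); case: (odd l); case: (par).
  by rewrite eqxx lp.
have minus_adj k l : k < 5 -> l < 5 -> odd k == par -> odd l == par -> adj G (o k) (o l) = false.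
  by move=> k5 l5 /eqP kp /eqP lp; rewrite (model_outer mod) // /outer_adj kp lp eqxx /= !andbF.
rewrite /special_form nm5 labelled_iota; split.
- by move: nm m9; clear; lia.
- exact/induces_pathP.
- move=> Y; rewrite in_setU1 => /orP[/eqP->|/imsetP[u uX ->]]; apply/empty_inducedP => x y.
    move=> xM yM; have [[xX _] [yX _]] := (elimT (XminusP _ _ _) xM, elimT (XminusP _ _ _) yM).
    have [[k k5 xk] [l l5 yl]] := (out x xX, out y yX); rewrite xk yl in xM yM *.
    by rewrite !minusP // in xM yM; apply: minus_adj.
  move=> xT yT; have [/setIdP[xt nux] /setIdP[yt nuy]] := (xT, yT).
  have [[xX _] [yX _]] := (elimT (XtwinP _ _ uX) xt, elimT (XtwinP _ _ uX) yt).
  have [[k k5 xk] [l l5 yl]] := (out x xX, out y yX); rewrite xk yl in xt yt nux nuy *.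
  rewrite twinP // in xt; rewrite twinP // in yt.
  case/andP: xt => /eqP u0 kp; case/andP: yt => _ lp.
  by rewrite class_adj // -(twin0 k) // -u0 (negPf nux) andbF.
- move=> Y; rewrite in_setU1 => /orP[/eqP->|/imsetP[u uX ->]]; apply/complete_inducedP => x y.
    move=> /setIdP[]; rewrite inE => xX; have [k k5 ->] := out x xX.
    move=> /forall_inP h _ _; have [kp|kp] := boolP (odd k == par).
      by have := h _ h0X; rewrite (model_minus_adj mod).
    have m2 : 2 < m by apply: leq_trans m9.
    by have := h _ (mem_path_set vertex m2); rewrite (model_attached mod) // /attached andbF.
  move=> xT yT xy; have [/setIdP[xt nux] /setIdP[yt nuy]] := (xT, yT).
  have [[xX _] [yX _]] := (elimT (XtwinP _ _ uX) xt, elimT (XtwinP _ _ uX) yt).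
  have [[k k5 xk] [l l5 yl]] := (out x xX, out y yX); rewrite xk yl in xt yt nux nuy xy *.
  rewrite twinP // in xt; rewrite twinP // in yt.
  case/andP: xt => /eqP u0 kp; case/andP: yt => _ lp.
  rewrite class_adj // -(twin0 k) // -u0 nux andbT.
  by apply: contraNneq xy => ->.
have gX (k : 'I_5) : o k \in ~: X by rewrite inE oX.
pose g (k : 'I_5) : {v | v \in ~: X} :=
  exist (fun v => v \in ~: X) (o k) (gX k).
have ginj : injective g.
  by move=> k l /(congr1 val) /= /oinj E; apply: val_inj; apply: E.
have cardX : #|{: {v | v \in ~: X}}| = 5.
  have E : #|~: X| = 5 by rewrite (card_path_setC pf) card_ord {1}nm addKn.
  by rewrite card_sig -{}E; apply: eq_card.
have [F FK KF] := inj_card_bij ginj (eq_leq (etrans cardX (esym (card_ord 5)))).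
have gE : forall k l : 'I_5, adj (outside_graph G X) (g k) (g l) = consecutive k l.
  move=> k l; rewrite /= /outside_rel (inj_eq ginj).
  case: eqVneq => [->|kl] /=; first by rewrite consecutive_parity.
  exact: (model_outside_edge m9 mod).
split.
  exists F; split; first by exists g.
  move=> x y; rewrite -{2}[x]KF -{2}[y]KF gE /= /path_rel /label /consecutive !eqSS.
  by [].
exists (vertex 0); first by rewrite /label val_vertex // (leq_trans m0) // mn.
(* Selecting the twins of [vertex 0] by comparison with [sgn] treats both alternatives of the
   bipartition at once. *)
have bip : bipartition (outside_graph G X) (trace (~: X) (Xminus G X))
    (trace (~: X) [set v in Xtwin G X (vertex 0) | adj G (vertex 0) v == sgn]).
  have AE k : (g k \in trace (~: X) (Xminus G X)) = (odd k == par).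
    by rewrite inE /= minusP.
  have BE k : (g k \in trace (~: X)
      [set v in Xtwin G X (vertex 0) | adj G (vertex 0) v == sgn]) = (odd k != par).
    rewrite inE /= inE twinP // eqxx /=; case: eqP => //= /eqP kp.
    by rewrite twin0 // eqxx.
  split.
  - by apply/setP => x; rewrite -[x]KF in_setI AE BE in_set0 andbN.
  - by apply/setP => x; rewrite -[x]KF in_setU AE BE in_setT orbN.
  - apply/empty_inducedP => x y; rewrite -[x]KF -[y]KF !AE gE => /eqP kp /eqP lp.
    by rewrite consecutive_parity // kp lp.
  - apply/empty_inducedP => x y; rewrite -[x]KF -[y]KF !BE gE => kp lp.
    rewrite consecutive_parity //.
    by move: kp lp; clear; case: (odd _); case: (odd _); case: (par).
have [sE|sE] := boolP sgn; [right | left].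
  have <- : [set v in Xtwin G X (vertex 0) | adj G (vertex 0) v == sgn] =
      Xtwin_plus G X (vertex 0).
    by apply/setP => v; rewrite !in_set sE eqb_id.
  exact: bip.
have <- : [set v in Xtwin G X (vertex 0) | adj G (vertex 0) v == sgn] =
    Xtwin_minus G X (vertex 0).
  by apply/setP => v; rewrite !in_set (negPf sE) eqbF_neg.
exact: bip.
Qed.

Lemma special_model : special_form G -> exists par sgn h, is_model G m par sgn h.
Proof.
have nm5 : n - 5 = m by rewrite nm addnK.
rewrite /special_form nm5 labelled_iota => -[_ /induces_pathP pf qm qp [[f [bf fE]] [v1 v11 bip]]].
have m0 : 0 < m by apply: leq_ltn_trans m9.
have v1E : v1 = vertex 0.
  by apply: ord_inj; case: v11 => ->; rewrite val_vertex // (leq_trans m0) // mn.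
subst v1; have h0X : vertex 0 \in X by apply: mem_path_set.
have indX : indec G X by apply: indec_path pf; apply: leq_trans m9.
have X3 : 2 < #|X| by rewrite (card_path_set pf); apply: leq_trans m9.
have [inj ad] := pf.
(* The two alternatives are merged: [B] is the second colour class, and [sgn] tells whether it is
   complete or empty. *)
have {bip} [sgn [B [bipB BP Badj]]] : exists sgn B,
   [/\ bipartition (outside_graph G X) (trace (~: X) (Xminus G X)) (trace (~: X) B),
       forall v, v \in B -> [/\ v \notin X, in_block G X (Some (vertex 0)) v & adj G (vertex 0) v = sgn]
     & forall x y, x \in B -> y \in B -> x != y -> adj G x y = sgn].
  case: bip => bip; [exists false, (Xtwin_minus G X (vertex 0))
                    | exists true, (Xtwin_plus G X (vertex 0))]; split=> //.
  - by move=> v /setIdP[/(XtwinP _ _ h0X)[vX hv] /negbTE].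
  - move=> x y xB yB _; apply: (elimT (empty_inducedP _ _)) xB yB; apply: qm.
    by rewrite in_setU1; apply/orP; right; apply: imset_f.
  - by move=> v /setIdP[/(XtwinP _ _ h0X)[vX hv] ->].
  - move=> x y xB yB xy; apply: (elimT (complete_inducedP _ _)) xB yB xy; apply: qp.
    by rewrite in_setU1; apply/orP; right; apply: imset_f.
have Mempty x y : x \in Xminus G X -> y \in Xminus G X -> adj G x y = false.
  by apply: (elimT (empty_inducedP _ _)); apply: qm; rewrite setU11.
have [g fK gK] := bf.
pose k5 k : 'I_5 := inord k.
pose ov k := val (g (k5 k)).
have oX k : ov k \notin X by have := valP (g (k5 k)); rewrite inE.
have [AB0 ABT /empty_inducedP EA /empty_inducedP EB] := bipB.
have trE A k : (g (k5 k) \in trace (~: X) A) = (ov k \in A) by rewrite in_set.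
have inAB k : (ov k \in B) = (ov k \notin Xminus G X).
  have := in_set0 (g (k5 k)); have := in_setT (g (k5 k)).
  rewrite -AB0 -ABT in_setI in_setU !trE.
  by case: (ov k \in B); case: (ov k \in _).
have gadj k l : k < 5 -> l < 5 -> adj (outside_graph G X) (g (k5 k)) (g (k5 l)) = consecutive k l.
  by move=> kl5 l5; rewrite -fE !gK /= /path_rel /label !eqSS !inordK.
have oinj k l : k < 5 -> l < 5 -> ov k = ov l -> k = l.
  move=> kl5 l5 /val_inj/(can_inj gK) E.
  by rewrite -(inordK kl5) -(inordK l5) -/(k5 k) E.
have alt k : k.+1 < 5 -> (ov k.+1 \in Xminus G X) = (ov k \notin Xminus G X).
  move=> k1; have kl5 := ltnW k1.
  have E : adj (outside_graph G X) (g (k5 k)) (g (k5 k.+1)).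
    by rewrite gadj // /consecutive eqxx orbT.
  have [kA|kA] := boolP (ov k \in Xminus G X); have [k1A|k1A] := boolP (ov k.+1 \in Xminus G X) => //.
    by rewrite EA ?trE in E.
  by rewrite EB ?trE ?inAB in E.
(* Colours alternate along P_5 by [alt], so the class of its first vertex decides all of them. *)
pose par := ov 0 \notin Xminus G X.
have inA k : k < 5 -> (ov k \in Xminus G X) = (odd k == par).
  elim: k => [_|k IH k1]; first by rewrite /par; case: (_ \in _).
  by rewrite alt // IH ?(ltnW k1) //=; case: (odd k); case: (par).
exists par, sgn, (fun i => if i < m then vertex i else ov (i - m)).
have att k j : k < 5 -> j < m -> adj G (ov k) (vertex j) = attached par sgn k j.
  move=> kl5 jm; rewrite /attached -inA //.
  have [/XminusP[_ h]|kA] := boolP (ov k \in Xminus G X).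
    by rewrite h // mem_path_set.
  have kB : ov k \in B by rewrite inAB.
  have [_ [_ hk] sk] := BP _ kB; have [->|j0] := eqVneq j 0.
    by rewrite adj_sym sk.
  rewrite hk ?mem_path_set // ?ad // /consecutive /= ?orbF //.
  by apply: contra j0 => /eqP/(inj _ _ jm m0)->.
(* A vertex of X^- keeps its block when [y] is added exactly if it is not adjacent to [y]. *)
have cross x y : x \in Xminus G X -> y \in B -> 
    adj G x y = indec G (X :|: [set x; y]).
  move=> /XminusP[xX hx] yB; have [yX hy _] := BP _ yB.
  have nx : in_block G X None x by move=> s t sX tX; rewrite !hx.
  have xy : x != y.
    by apply/eqP => E; rewrite E in nx; have := in_block_uniq indX X3 nx hy.
  rewrite setUC -setUA; apply/idP/idP => [adxy|].
    apply: indecU2 nx hy _ => // /(_ y (vertex 0)); rewrite setU11 setU1r // => /(_ isT isT).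
    by rewrite adxy hx.
  apply: contraLR => nadj; apply: (@in_block_not_indecU2 _ _ _ None) => //; first exact: ltnW.
  have K z : z \in y |: X -> adj G x z = false.
    by rewrite in_setU1 => /orP[/eqP->|/hx//]; apply/negbTE.
  by move=> s t /K-> /K->.
have outE k l : k < 5 -> l < 5 -> k != l -> indec G (X :|: [set ov k; ov l]) = consecutive k l.
  move=> kl5 l5 kl; rewrite -gadj // /= /outside_rel.
  by rewrite (inj_eq (can_inj gK)) -(inj_eq val_inj) /= !inordK // kl.
have out k l : k < 5 -> l < 5 -> adj G (ov k) (ov l) = outer_adj par sgn k l.
  move=> kl5 l5; rewrite /outer_adj; have [<-|kl] := eqVneq k l.
    by rewrite adj_irr eqxx.
  have okl : ov k != ov l by apply: contra kl => /eqP/oinj->.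
  have [kA|kA] := boolP (ov k \in Xminus G X); have [lA|lA] := boolP (ov l \in Xminus G X).
  - have kp := kA; have lp := lA; rewrite inA // in kp; rewrite inA // in lp.
    by rewrite Mempty // (eqP kp) (eqP lp) eqxx.
  - have kp := kA; have lp := lA; rewrite inA // in kp; rewrite inA // in lp.
    by rewrite cross ?inAB // outE // (eqP kp) eq_sym (negPf lp).
  - have kp := kA; have lp := lA; rewrite inA // in kp; rewrite inA // in lp.
    have lk : l != k by rewrite eq_sym.
    by rewrite adj_sym cross ?inAB // outE // (eqP lp) (negPf kp) consecutive_sym.
  - have kp := kA; have lp := lA; rewrite inA // in kp; rewrite inA // in lp.
    rewrite Badj ?inAB //; have -> : odd k = odd l.
      by move: kp lp; clear; case: (odd k); case: (odd l); case: (par).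
    by rewrite eqxx lp.
have im i : ~~ (i < m) -> i < m + 5 -> i - m < 5 /\ m <= i.
  by rewrite -leqNgt => mi im; rewrite ltn_subLR.
split; first by rewrite card_ord.
  move=> i j im5 jm5; have [im'|im'] := boolP (i < m); have [jm'|jm'] := boolP (j < m).
  - exact: inj.
  - by move=> E; have := oX (j - m); rewrite -E mem_path_set.
  - by move=> E; have := oX (i - m); rewrite E mem_path_set.
  - have [[i5 mi] [j5 mj]] := (im _ im' im5, im _ jm' jm5).
    by move=> /(oinj _ _ i5 j5) E; rewrite -(subnKC mi) E subnKC.
move=> i j im5 jm5; rewrite /model_adj; case: (ifPn (i < m)) => im'; case: (ifPn (j < m)) => jm'.
- exact: ad.
- by have [j5 _] := im _ jm' jm5; rewrite adj_sym att.
- by have [i5 _] := im _ im' im5; rewrite att.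
- by have [[i5 mi] [j5 mj]] := (im _ im' im5, im _ jm' jm5); rewrite out.
Qed.

End Canonical.

(** This representative fits both descriptions, while an element of P_{-5} whose outside vertices
    are twins of the end n - 5 is only isomorphic to a graph of the special form. *)
Lemma is_model_model_graph m par sgn :
  is_model (model_graph m par sgn) m par sgn (vertex (erefl (m + 5))).
Proof.
split; first by rewrite card_ord.
  exact: vertex_inj.
by move=> i j im jm; rewrite /= /model_rel !val_vertex.
Qed.

Unset Implicit Arguments.

Theorem proposition4p10 (T : finType) (H : graph T) :
  (exists (n : nat) (G : graph 'I_n), Pminus5 G /\ isomorphic H G) <->
  (exists (n : nat) (G : graph 'I_n), special_form G /\ isomorphic H G).
Proof.
have size n : 14 <= n -> n = n - 5 + 5 /\ 8 < n - 5 by move=> n14; lia.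
split=> -[n [G [hG HG]]].
- have [nE m9] : n = n - 5 + 5 /\ 8 < n - 5 by apply: size; case: hG.
  have [par [sgn [h mod]]] := Pminus5_model nE m9 hG.
  exists (n - 5 + 5), (model_graph (n - 5) par sgn); split.
    exact: (model_special m9 (is_model_model_graph _ par sgn)).
  exact: isomorphic_trans HG (is_model_iso mod).
- have [nE m9] : n = n - 5 + 5 /\ 8 < n - 5 by apply: size; case: hG.
  have [par [sgn [h mod]]] := special_model nE m9 hG.
  exists (n - 5 + 5), (model_graph (n - 5) par sgn); split.
    exact: (model_Pminus5 m9 (is_model_model_graph _ par sgn)).
  exact: isomorphic_trans HG (is_model_iso mod).
Qed.
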